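(* Let $m,n$ be coprime positive integers and let $\mathcal X_{3,\tau}^*\cong\mathcal M/H$ be a $4$-dimensional component of the irreducible locus of the $\mathrm{SL}(3,\mathbb C)$-character variety $\mathcal X_3$ of the torus knot $K_{m,n}$, where $H=T\times_DT$. Then its closure in $\mathcal X_3$ is $$\overline{\mathcal X_{3,\tau}^*}=\mathrm{GL}(3,\mathbb C)/\!/H .$$ The boundary strata are given by: \begin{itemize} \item Orbits coming from $3\times3$ matrices $M$ with two zeroes in a row or in a column. The representation is S-equivalent to a direct sum $V\oplus W$ of an irreducible two-dimensional and a one-dimensional representation, so it is partially reducible. \item Orbits coming from $3\times3$ matrices $M$ with three zeroes, two in a row and two in a column (one of these zeroes in common). The representation is S-equivalent to a diagonal one, i.e. to a totally reducible representation $V\oplus V'\oplus V''$. \end{itemize} The boundary consists of $9$ lines of partially reducible representations that intersect each other following the pattern of the complete bipartite graph $K_{3,3}$ (the lines corresponding to the edges and the intersection points to the vertices). In addition, the intersection points are precisely the totally reducible representations.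
   Context: The knot group is $\Gamma=\langle x,y\mid x^n=y^m\rangle$; $\mathcal X_3$ is the affine GIT quotient by conjugation of the set of pairs $(A,B)\in\mathrm{SL}(3,\mathbb C)^2$ with $A^n=B^m$. Two representations are S-equivalent if they have the same semisimplification (equivalently, define the same point of $\mathcal X_3$). A $4$-dimensional component $\mathcal X^*_{3,\tau}$ consists of the irreducible $(A,B)$ with prescribed eigenvalues: $\tau$ records three distinct eigenvalues $\epsilon_1,\epsilon_2,\epsilon_3$ of $A$ and three distinct eigenvalues $\varepsilon_1,\varepsilon_2,\varepsilon_3$ of $B$, with $\prod\epsilon_i=\prod\varepsilon_j=1$ and $\epsilon_i^n=\varepsilon_j^m=\omega$, $\omega^3=1$. To $(A,B)$ one associates the matrix $M=(a_{ij})\in\mathrm{GL}(3,\mathbb C)$ whose $j$-th column gives the coordinates of the eigenvector $w_j$ of $B$ (eigenvalue $\varepsilon_j$) in the basis $v_1,v_2,v_3$ of eigenvectors of $A$ (with eigenvalues $\epsilon_i$); conversely every $M\in\mathrm{GL}(3,\mathbb C)$ defines a representation. Let $T$ be the group of diagonal matrices in $\mathrm{GL}(3,\mathbb C)$; $T\times T$ acts on $\mathrm{GL}(3,\mathbb C)$ by left multiplication by the first factor and right multiplication by the second factor, $D=\{(\lambda\,\mathrm{Id},\lambda^{-1}\mathrm{Id})\}$ acts trivially, and $T\times_DT=(T\times T)/D$. Rescaling the eigenvectors corresponds to this action. $\mathcal M\subset\mathrm{GL}(3,\mathbb C)$ is the open set of stable points (closed orbit and trivial stabilizer in $T\times_DT$),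 equivalently of those $M$ that yield irreducible representations, and $\mathcal X_{3,\tau}^*\cong\mathcal M/H$. The boundary is $\overline{\mathcal X_{3,\tau}^*}\setminus\mathcal X_{3,\tau}^*$. *)

(* Defs.v *)
From HB Require Import structures.
From mathcomp Require Import all_boot all_order all_algebra generic_quotient.
From mathcomp Require Import boolp classical_sets reals.
From mathcomp Require Import mpoly complex.

Set Implicit Arguments.
Unset Strict Implicit.
Unset Printing Implicit Defensive.

Import GRing.Theory.

Local Open Scope classical_set_scope.
Local Open Scope ring_scope.
Local Open Scope quotient_scope.

(* An affine variety over the algebraically closed field K is presented as a
   space with functions: its set of closed points together with its ring of
   regular functions. *)
Section Varieties.
Variable K : closedFieldType.

Record variety := Variety { pts :> Type; reg : set (pts -> K) }.
Arguments reg : clear implicits.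

Definition morphism (X Y : variety) (phi : X -> Y) : Prop :=
  forall f, reg Y f -> reg X (f \o phi).

Definition isomorphism (X Y : variety) (phi : X -> Y) : Prop :=
  morphism phi /\
  exists psi : Y -> X, [/\ morphism psi, cancel phi psi & cancel psi phi].

Definition zclosed (X : variety) (Z : set X) : Prop :=
  exists2 F : set (X -> K),
    F `<=` reg X & Z = [set x | forall f, F f -> f x = 0].

Definition zclosure (X : variety) (Z : set X) : set X :=
  smallest (@zclosed X) Z.

(* Meant for closed Z: the regular functions are then the restrictions. *)
Definition subvariety (X : variety) (Z : set X) : variety :=
  @Variety {x : X | Z x}
    [set f | exists2 g, reg X g & forall z, f z = g (sval z)].

(* The variety structure on X for which the coordinate map c is an embedding;
   meant for c injective with Zariski closed image. *)
Definition embedded (N : nat) (X : Type) (c : X -> 'rV[K]_N) : variety :=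
  @Variety X [set f | exists P : {mpoly K[N]},
                        forall x, f x = P.@[fun i => c x 0 i]].

Definition affine_line : variety := embedded (fun t : K => t%:M : 'rV[K]_1).

(* Affine GIT quotient: the closed points of Spec K[X]^G are the K-algebra
   morphisms K[X]^G -> K. *)
Section GIT.
Variables (X : variety) (G : Type) (act : G -> X -> X).

Definition invariant_fun :=
  {f : X -> K | reg X f /\ forall g x, f (act g x) = f x}.

Definition is_character (chi : invariant_fun -> K) : Prop :=
  [/\ forall (a : K) f, (forall x, sval f x = a) -> chi f = a,
      forall f g h, (forall x, sval h x = sval f x + sval g x) ->
        chi h = chi f + chi g
    & forall f g h, (forall x, sval h x = sval f x * sval g x) ->
        chi h = chi f * chi g].

Definition git : variety :=
  @Variety {chi | is_character chi}
    [set F | exists f : invariant_fun, forall p, F p = sval p f].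

Lemma is_character_eval (x : X) :
  is_character (fun f : invariant_fun => sval f x).
Proof. by split=> [a f ->|f g h ->|f g h ->]. Qed.

Definition git_pi (x : X) : git := exist _ _ (is_character_eval x).

End GIT.
End Varieties.
Arguments reg {K} X : rename.

(* A d-dimensional representation x |-> A, y |-> B of <x, y | x^n = y^m> is
   the pair (A, B), the matrices acting on column vectors. *)
Section Representations.
Variable K : closedFieldType.

Definition mxpair (d : nat) := ('M[K]_d * 'M[K]_d)%type.

Definition is_rep (n m d : nat) (r : mxpair d) : Prop :=
  [/\ r.1 \in unitmx, r.2 \in unitmx & r.1 ^+ n = r.2 ^+ m].

Definition conj_pair (d : nat) (P : 'M[K]_d) (r : mxpair d) : mxpair d :=
  (P *m r.1 *m invmx P, P *m r.2 *m invmx P).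

Definition similar_pair (d : nat) (r s : mxpair d) : Prop :=
  exists2 P, P \in unitmx & s = conj_pair P r.

(* Subspaces are row spaces in mxalgebra, so invariance of a subspace of
   column vectors is stability under the transposes. *)
Definition irreducible_pair (d : nat) (r : mxpair d) : Prop :=
  (0 < d)%N /\
  forall U : 'M[K]_d, stablemx U r.1^T -> stablemx U r.2^T ->
    U = 0 \/ row_full U.

Definition dsum (p q : nat) (r : mxpair p) (s : mxpair q) : mxpair (p + q) :=
  (block_mx r.1 0 0 s.1, block_mx r.2 0 0 s.2).

(* [semisimplification r s]: s is (isomorphic to) the direct sum of the
   composition factors of r. *)
Inductive semisimplification :
    forall d : nat, mxpair d -> mxpair d -> Prop :=
| Semisimpl_irr d (r : mxpair d) :
    irreducible_pair r -> semisimplification r r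
| Semisimpl_ext p q (r r' : mxpair p) (s s' : mxpair q)
    (X Y : 'M[K]_(p, q)) :
    semisimplification r r' -> semisimplification s s' ->
    semisimplification
      ((block_mx r.1 X 0 s.1, block_mx r.2 Y 0 s.2) : mxpair (p + q))
      (dsum r' s')
| Semisimpl_conj d (r r' s s' : mxpair d) :
    semisimplification r s -> similar_pair r r' -> similar_pair s s' ->
    semisimplification r' s'.

Definition S_equivalent (d : nat) (r s : mxpair d) : Prop :=
  exists2 t : mxpair d, semisimplification r t & semisimplification s t.

Definition partially_reducible (n m : nat) (r : mxpair 3) : Prop :=
  exists (V : mxpair 2) (W : mxpair 1),
    [/\ is_rep n m V, is_rep n m W, irreducible_pair V
      & S_equivalent r (dsum V W)].

Definition totally_reducible (n m : nat) (r : mxpair 3) : Prop :=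
  exists V V' V'' : mxpair 1,
    [/\ is_rep n m V, is_rep n m V', is_rep n m V''
      & S_equivalent r (dsum (dsum V V') V'')].

End Representations.

Section CharacterVariety.
Variables (K : closedFieldType) (n m : nat).

Definition SL3 := {P : 'M[K]_3 | \det P == 1}.

Definition is_SL3rep (r : mxpair K 3) : bool :=
  [&& \det r.1 == 1, \det r.2 == 1 & r.1 ^+ n == r.2 ^+ m].

Definition repvar : variety K :=
  embedded (fun r : {r : mxpair K 3 | is_SL3rep r} =>
    row_mx (mxvec (sval r).1) (mxvec (sval r).2)).

Lemma conjmx_exp (d k : nat) (P A : 'M[K]_d) : P \in unitmx ->
  (P *m A *m invmx P) ^+ k = P *m A ^+ k *m invmx P.
Proof.
move=> uP; elim: k => [|k IHk].
  by rewrite !expr0 mulmx1 mulmxV.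
rewrite !exprS IHk -[LHS]/(_ *m _) -[A * _]/(A *m _).
by rewrite !mulmxA mulmxKV.
Qed.

Lemma det_conjmx (d : nat) (P A : 'M[K]_d) : P \in unitmx ->
  \det (P *m A *m invmx P) = \det A.
Proof.
move=> uP; rewrite !det_mulmx mulrAC -det_mulmx mulmxV //.
by rewrite det1 mul1r.
Qed.

Lemma SL3_act_proof (P : SL3) (r : repvar) :
  is_SL3rep (conj_pair (sval P) (sval r)).
Proof.
have uP : sval P \in unitmx.
  by rewrite unitmxE (eqP (svalP P)) unitr1.
case/and3P: (svalP r) => dA dB AB; apply/and3P; split => /=.
- by rewrite det_conjmx.
- by rewrite det_conjmx.
- by rewrite !conjmx_exp // (eqP AB).
Qed.

Definition SL3_act (P : SL3) (r : repvar) : repvar :=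
  exist (fun s : mxpair K 3 => is_SL3rep s) _ (SL3_act_proof P r).

Definition charvar : variety K := git SL3_act.

Definition charpt (r : repvar) : charvar := git_pi SL3_act r.

Definition partially_reducible_pts : set charvar :=
  [set charpt r | r in [set r : repvar | partially_reducible n m (sval r)]].

Definition totally_reducible_pts : set charvar :=
  [set charpt r | r in [set r : repvar | totally_reducible n m (sval r)]].

Record component_type := ComponentType {
  eps : 'I_3 -> K;
  veps : 'I_3 -> K;
  omega : K;
  eps_inj : injective eps;
  veps_inj : injective veps;
  prod_eps : \prod_i eps i = 1;
  prod_veps : \prod_j veps j = 1;
  omega3 : omega ^+ 3 = 1;
  eps_exp : forall i, eps i ^+ n = omega;
  veps_exp : forall j, veps j ^+ m = omega
}.

(* The component X^*_{3,tau}; the eigenvalues listed by tau being distinct,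
   they are all the eigenvalues of A and of B. *)
Definition component (tau : component_type) : set charvar :=
  [set charpt r | r in [set r : repvar |
    [/\ irreducible_pair (sval r),
        forall i, eigenvalue (sval r).1 (eps tau i)
      & forall j, eigenvalue (sval r).2 (veps tau j)]]].

Definition boundary (tau : component_type) : set charvar :=
  zclosure (component tau) `\` component tau.

End CharacterVariety.

Section GL3quotient.
Variable K : closedFieldType.

Definition GL3 : variety K :=
  embedded (fun M : {M : 'M[K]_3 | M \in unitmx} =>
    row_mx (mxvec (sval M)) ((\det (sval M))^-1%:M : 'rV[K]_1)).

Definition diagGL3 := {t : 'M[K]_3 | is_diag_mx t && (t \in unitmx)}.

(* Equality modulo D = {(c Id, c^-1 Id)}. *)
Definition eqD (u v : diagGL3 * diagGL3) : bool :=
  `[< exists2 c : K, c != 0 &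
        sval v.1 = c *: sval u.1 /\ sval v.2 = c^-1 *: sval u.2 >].

Lemma eqD_refl : reflexive eqD.
Proof.
by move=> u; apply/asboolP; exists 1; rewrite ?oner_neq0// invr1 !scale1r.
Qed.

Lemma eqD_sym : ssrbool.symmetric eqD.
Proof.
suff imp u v : eqD u v -> eqD v u by move=> u v; apply/idP/idP; apply: imp.
case/asboolP=> c c0 [e1 e2]; apply/asboolP; exists c^-1; first by rewrite invr_eq0.
by rewrite e1 e2 !scalerA invrK mulVf// mulfV// !scale1r.
Qed.

Lemma eqD_trans : transitive eqD.
Proof.
move=> v u w /asboolP[c c0 [e1 e2]] /asboolP[d d0 [e3 e4]].
apply/asboolP; exists (d * c); first by rewrite mulf_neq0.
by rewrite e3 e4 e1 e2 !scalerA invfM.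
Qed.

Canonical eqD_equiv := EquivRel eqD eqD_refl eqD_sym eqD_trans.

(* The group H = (T x T) / D. *)
Definition torusH := {eq_quot eqD}.

Lemma TT_act_proof (u : diagGL3 * diagGL3) (M : GL3) :
  sval u.1 *m sval M *m sval u.2 \in unitmx.
Proof.
case/andP: (svalP u.1) => _ u1; case/andP: (svalP u.2) => _ u2.
by rewrite !unitmx_mul u1 u2 (svalP M).
Qed.

Definition TT_act (u : diagGL3 * diagGL3) (M : GL3) : GL3 :=
  exist (fun N : 'M[K]_3 => N \in unitmx) _ (TT_act_proof u M).

Definition H_act (h : torusH) : GL3 -> GL3 := TT_act (repr h).

Lemma H_actE (u : diagGL3 * diagGL3) : H_act (\pi_torusH u) =1 TT_act u.
Proof.
move=> M; apply: val_inj => /=.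
have : eqD (repr (\pi_torusH u)) u by rewrite -[eqD _ _]/(eqD_equiv _ _) -eqmodE reprK.
case/asboolP=> c c0 [-> ->].
by rewrite -scalemxAr -!scalemxAl scalerA mulVf// scale1r.
Qed.

Definition GL3_mod_H : variety K := git H_act.

Definition GL3pt (M : GL3) : GL3_mod_H := git_pi H_act M.

(* An invertible 3x3 matrix has at most two zeroes in a row or column. *)
Definition two_zeros_row (M : 'M[K]_3) (i : 'I_3) : Prop :=
  #|[pred j | M i j == 0]| = 2%N.

Definition two_zeros_col (M : 'M[K]_3) (j : 'I_3) : Prop :=
  #|[pred i | M i j == 0]| = 2%N.

Definition zero_line (M : 'M[K]_3) : Prop :=
  (exists i, two_zeros_row M i) \/ (exists j, two_zeros_col M j).

Definition zero_corner (M : 'M[K]_3) : Prop :=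
  exists i j, [/\ two_zeros_row M i, two_zeros_col M j & M i j = 0].

Definition zero_count (M : 'M[K]_3) : nat :=
  #|[pred p : 'I_3 * 'I_3 | M p.1 p.2 == 0]|.

(* The representation attached to M, written in the basis of eigenvectors of
   A; the j-th column of M is an eigenvector of B for veps j. *)
Definition rho_pair n m (tau : component_type K n m) (M : 'M[K]_3) :
    mxpair K 3 :=
  (diag_mx (\row_i eps tau i),
   M *m diag_mx (\row_j veps tau j) *m invmx M).

Lemma diag_mx_exp (d k : nat) (a : 'I_d -> K) :
  diag_mx (\row_i a i) ^+ k = diag_mx (\row_i a i ^+ k).
Proof.
elim: k => [|k IHk].
  by apply/matrixP => i j; rewrite expr0 !mxE expr0.
rewrite exprS IHk -[LHS]/(_ *m _) mulmx_diag; congr diag_mx.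
by apply/rowP => i; rewrite !mxE exprS.
Qed.

Lemma rho_proof n m (tau : component_type K n m) (M : GL3) :
  is_SL3rep n m (rho_pair tau (sval M)).
Proof.
have uM := svalP M; apply/and3P; split=> /=.
- rewrite det_diag (eq_bigr (eps tau)) ?prod_eps// => i _.
  by rewrite mxE.
- rewrite det_conjmx// det_diag (eq_bigr (veps tau)) ?prod_veps// => i _.
  by rewrite mxE.
- rewrite conjmx_exp// !diag_mx_exp.
  have dcst (a : 'I_3 -> K) c :
      (forall i, a i = c) -> diag_mx (\row_i a i) = c%:M.
    by move=> ac; apply/matrixP => i j; rewrite !mxE ac.
  rewrite (dcst _ _ (eps_exp tau)) (dcst _ _ (veps_exp tau)).
  by rewrite scalar_mxC mulmxK.
Qed.

Definition rho n m (tau : component_type K n m) (M : GL3) : repvar K n m :=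
  exist (fun s : mxpair K 3 => is_SL3rep n m s) _ (rho_proof tau M).

(* The set M of those matrices yielding irreducible representations. *)
Definition irreducible_locus n m (tau : component_type K n m) : set GL3 :=
  [set M | irreducible_pair (sval (rho tau M))].

Definition orbits_from n m (tau : component_type K n m)
    (P : 'M[K]_3 -> Prop) : set (charvar K n m) :=
  [set charpt (rho tau M) | M in [set M : GL3 | P (sval M)]].

End GL3quotient.

Definition K33_vertex := ('I_3 + 'I_3)%type.
Definition K33_edge := ('I_3 * 'I_3)%type.
Definition K33_incident (e : K33_edge) (w : K33_vertex) : Prop :=
  w = inl e.1 \/ w = inr e.2.

(* Main.v *)
Require Import Defs.
From mathcomp Require Import all_boot all_order all_algebra fingroup perm.
From mathcomp Require Import boolp classical_sets reals.
From mathcomp Require Import mpoly ring zify complex.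
Import Order.TTheory GRing.Theory Num.Theory.
Local Open Scope classical_set_scope.
Local Open Scope ring_scope.

(** The six signed terms of the Leibniz formula of a matrix [M], divided by
    [\det M], are unchanged when the rows and the columns of [M] are rescaled,
    and they generate the ring of all functions with this property: once a power
    of the determinant is cleared, such a function is a polynomial homogeneous
    of one and the same degree N in every row and every column, and an exponent
    array of order three with all line sums equal to N is a sum of N permutation
    matrices ([birkhoff3], [torus_invariants]).

    Each of these six coordinates is also the restriction along [rho] of a
    conjugation invariant of pairs.  Let P_i and Q_j be the spectral projectors
    of A and B, which are polynomials in A and B.  Then
    tr (P_0 Q_j) tr (P_1 Q_k) - tr (P_0 Q_j P_1 Q_k) is the product of two
    entries of M and a minor of its inverse, hence a signed Leibniz term divided
    by the determinant, by Jacobi's identity ([lcoord_minor], [lcoord_inv_rho]).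
    So restriction along [rho] maps the invariants of pairs onto the torus
    invariants ([pull_surj]).  Its kernel consists of the invariants vanishing
    on the component, because matrices without zero entries are dense and give
    irreducible pairs ([density], [vanish_component]).  This identifies the
    quotient of the general linear group with the closure of the component
    ([phi_isomorphism]).

    In the six coordinates the closure is the set where their sum is one and the
    product of the even ones is minus the product of the odd ones; every
    solution comes from a matrix ([realise_lcoord], [closure_orbit]).  A pair is
    reducible exactly when M has two zeroes in a row or a column, and this means
    that at most two coordinates survive, one belonging to an even and one to an
    odd permutation ([zero_line_supported], [supported_zero_line]).  An even and
    an odd permutation of three letters agree on exactly one letter, so there
    are nine such pairs of permutations: the edges of the complete bipartite
    graph on three even and three odd vertices.  Along an edge the two surviving
    coordinates add up to one, which gives a line, and the vertices are the
    points with a single nonzero coordinate.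

    On a line, away from its vertices, M is block triangular up to the order of
    the eigenvectors, with a block of order two without zero entries; over a
    vertex it can be taken triangular.  This gives the semisimplifications.
    That only the vertices are totally reducible follows from a trace identity:
    the projectors have rank one, so tr (P Q P Q) is the square of tr (P Q) for
    P = P_i and Q = Q_j, whereas in a sum of characters they are commuting
    idempotents and tr (P Q P Q) = tr (P Q).  Applied to a cell (i, j) met by
    one permutation of the edge, this says that the coordinate t on the line
    satisfies t^2 = t ([totally_reducible_trace], [range_vertex]). *)

Set Implicit Arguments.
Unset Strict Implicit.

(** * Algebras of functions generated by a family *)

Section Gen.
Variables (K : closedFieldType) (X : Type).

Inductive gen (I : Type) (g : I -> X -> K) : (X -> K) -> Prop :=
| gen_cst c : gen g (fun=> c)
| gen_var i : gen g (g i)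
| gen_add f h : gen g f -> gen g h -> gen g (fun x => f x + h x)
| gen_mul f h : gen g f -> gen g h -> gen g (fun x => f x * h x).

Variables (I : Type) (g : I -> X -> K).

Lemma gen_ext f h : f =1 h -> gen g f -> gen g h.
Proof. by move=> /funext ->. Qed.

Lemma gen_opp f : gen g f -> gen g (fun x => - f x).
Proof.
move=> gf; apply: gen_ext (gen_mul (gen_cst g (-1)) gf) => x.
by rewrite mulN1r.
Qed.

Lemma gen_sub f h : gen g f -> gen g h -> gen g (fun x => f x - h x).
Proof. by move=> gf gh; apply: gen_add => //; apply: gen_opp. Qed.

Lemma gen_sum (J : Type) (r : seq J) (P : pred J) (F : J -> X -> K) :
  (forall j, P j -> gen g (F j)) -> gen g (fun x => \sum_(j <- r | P j) F j x).
Proof.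
move=> gF; elim: r => [|j r IH].
  by apply: gen_ext (gen_cst g 0) => x; rewrite big_nil.
case Pj: (P j); last by apply: gen_ext IH => x; rewrite big_cons Pj.
by apply: gen_ext (gen_add (gF j Pj) IH) => x; rewrite big_cons Pj.
Qed.

Lemma gen_prod (J : Type) (r : seq J) (P : pred J) (F : J -> X -> K) :
  (forall j, P j -> gen g (F j)) -> gen g (fun x => \prod_(j <- r | P j) F j x).
Proof.
move=> gF; elim: r => [|j r IH].
  by apply: gen_ext (gen_cst g 1) => x; rewrite big_nil.
case Pj: (P j); last by apply: gen_ext IH => x; rewrite big_cons Pj.
by apply: gen_ext (gen_mul (gF j Pj) IH) => x; rewrite big_cons Pj.
Qed.

Lemma gen_exp f k : gen g f -> gen g (fun x => f x ^+ k).
Proof.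
move=> gf; elim: k => [|k IH].
  by apply: gen_ext (gen_cst g 1) => x; rewrite expr0.
by apply: gen_ext (gen_mul gf IH) => x; rewrite exprS.
Qed.

Lemma gen_trans (J : Type) (h : J -> X -> K) f :
  (forall i, gen h (g i)) -> gen g f -> gen h f.
Proof.
move=> hg; elim=> {f} [c|i|f k _ hf _ hk|f k _ hf _ hk]; first exact: gen_cst.
- exact: hg.
- exact: gen_add.
- exact: gen_mul.
Qed.

End Gen.

Section GenComp.
Variables (K : closedFieldType).

Lemma gen_comp (X Y I : Type) (g : I -> X -> K) (phi : Y -> X) f :
  gen g f -> gen (fun i => g i \o phi) (f \o phi).
Proof.
elim=> {f} [c|i|f k _ hf _ hk|f k _ hf _ hk]; first exact: gen_cst.
- exact: (gen_var (fun i => g i \o phi) i).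
- exact: (gen_add hf hk).
- exact: (gen_mul hf hk).
Qed.

(** Regular functions become an inductively generated algebra, so statements
    about them are proved by induction rather than on polynomials. *)
Lemma reg_embedded (N : nat) (X : Type) (c : X -> 'rV[K]_N) f :
  reg (embedded c) f <-> gen (fun i x => c x 0 i) f.
Proof.
split=> [[P fP]|].
  apply: (@gen_ext _ _ _ _ (fun x => P.@[fun i => c x 0 i])) => [x|].
    by rewrite fP.
  apply: (@gen_ext _ _ _ _ (fun x => \sum_(m <- msupp P)
      P@_m * \prod_i c x 0 i ^+ m i)) => [x|]; first by rewrite mevalE.
  apply: gen_sum => m _; apply: gen_mul; first exact: gen_cst.
  apply: gen_prod => i _; apply: gen_exp.
  exact: (gen_var (fun i x => c x 0 i)).
elim=> {f} [a|i|f k _ [P fP] _ [Q kQ]|f k _ [P fP] _ [Q kQ]].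
- by exists a%:MP => x; rewrite mevalC.
- by exists 'X_i => x; rewrite mevalXU.
- by exists (P + Q) => x; rewrite mevalD fP kQ.
- by exists (P * Q) => x; rewrite mevalM fP kQ.
Qed.

Definition polyfun (I : Type) : ((I -> K) -> K) -> Prop :=
  gen (fun (i : I) (v : I -> K) => v i).

Lemma gen_polyfun (X I : Type) (h : I -> X -> K) f : gen h f ->
  exists2 g, polyfun g & forall x, f x = g (fun i => h i x).
Proof.
elim=> {f} [c|i|f k _ [F gF fF] _ [H gH hH]|f k _ [F gF fF] _ [H gH hH]].
- by exists (fun=> c) => //; exact: gen_cst.
- exists (fun v => v i) => //.
  exact: (gen_var (fun (i : I) (v : I -> K) => v i)).
- exists (fun v => F v + H v) => [|x]; first exact: gen_add.
  by rewrite fF hH.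
- exists (fun v => F v * H v) => [|x]; first exact: gen_mul.
  by rewrite fF hH.
Qed.

Definition subalgebra (X : Type) (S : set (X -> K)) : Prop :=
  [/\ forall a, S (fun=> a),
      forall f h, S f -> S h -> S (fun x => f x + h x)
    & forall f h, S f -> S h -> S (fun x => f x * h x)].

Lemma gen_subalgebra (X I : Type) (g : I -> X -> K) S f :
  subalgebra S -> (forall i, S (g i)) -> gen g f -> S f.
Proof.
case=> S0 SD SM Sg; elim=> // {}f h _ Sf _ Sh; [exact: SD|exact: SM].
Qed.

Lemma subalgebra_embedded (N : nat) (X : Type) (c : X -> 'rV[K]_N) :
  subalgebra (reg (embedded c)).
Proof.
split=> [a|f h /reg_embedded gf /reg_embedded gh|
         f h /reg_embedded gf /reg_embedded gh]; apply/reg_embedded.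
- exact: gen_cst.
- exact: gen_add.
- exact: gen_mul.
Qed.

Lemma reg_affine_line (f : K -> K) :
  reg (affine_line K) f <-> gen (fun (_ : unit) t => t) f.
Proof.
split=> [/reg_embedded|gf]; last first.
  apply: (gen_subalgebra (subalgebra_embedded _)) gf => _.
  by exists 'X_0 => t; rewrite mevalXU mxE eqxx.
apply: gen_trans => i; rewrite (ord1 i).
by apply: gen_ext (gen_var _ tt) => t; rewrite mxE eqxx.
Qed.

End GenComp.

(** * Points of an affine quotient *)

Section GitPoints.
Variables (K : closedFieldType) (X : variety K) (G : Type) (act : G -> X -> X).
Hypothesis algX : subalgebra (reg X).
Notation inv := (invariant_fun act).
Notation Q := (git act).

Definition git_val (F : inv) (p : Q) : K := sval p F.

Lemma git_val_pi F x : git_val F (git_pi act x) = sval F x.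
Proof. by []. Qed.

Lemma git_ext (p q : Q) : (forall F, git_val F p = git_val F q) -> p = q.
Proof.
case: p q => [p cp] [q cq] /= pq; have /funext e : p =1 q by exact: pq.
by case: q / e cq {pq} => cq; congr exist; apply: Prop_irrelevance.
Qed.

Lemma git_piP g x : git_pi act (act g x) = git_pi act x.
Proof. by apply: git_ext => F; rewrite !git_val_pi (svalP F).2. Qed.

Lemma inv_cst_proof (c : K) : reg X (fun=> c) /\ forall (g : G) (x : X), c = c.
Proof. by split=> //; case: algX. Qed.
Definition inv_cst c : inv := exist _ _ (inv_cst_proof c).

Lemma inv_add_proof (F H : inv) : reg X (fun x => sval F x + sval H x) /\
  forall g x, sval F (act g x) + sval H (act g x) = sval F x + sval H x.
Proof.
case: (svalP F) (svalP H) => [rF iF] [rH iH]; split=> [|g x].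
  by case: algX => _ + _; apply.
by rewrite iF iH.
Qed.
Definition inv_add F H : inv := exist _ _ (inv_add_proof F H).

Lemma inv_mul_proof (F H : inv) : reg X (fun x => sval F x * sval H x) /\
  forall g x, sval F (act g x) * sval H (act g x) = sval F x * sval H x.
Proof.
case: (svalP F) (svalP H) => [rF iF] [rH iH]; split=> [|g x].
  by case: algX => _ _; apply.
by rewrite iF iH.
Qed.
Definition inv_mul F H : inv := exist _ _ (inv_mul_proof F H).

Lemma git_val_cst c p : git_val (inv_cst c) p = c.
Proof. by have [C _ _] := svalP p; apply: (C c (inv_cst c)). Qed.
Lemma git_val_add F H p :
  git_val (inv_add F H) p = git_val F p + git_val H p.
Proof. by have [_ D _] := svalP p; apply: (D F H). Qed.
Lemma git_val_mul F H p :
  git_val (inv_mul F H) p = git_val F p * git_val H p.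
Proof. by have [_ _ D] := svalP p; apply: (D F H). Qed.

Lemma git_reg F : reg Q (git_val F).
Proof. by exists F. Qed.

Lemma subalgebra_git : subalgebra (reg Q).
Proof.
split=> [a|f h [F fF] [H hH]|f h [F fF] [H hH]].
- by exists (inv_cst a) => p; rewrite -[RHS]/(git_val _ p) git_val_cst.
- exists (inv_add F H) => p; rewrite -[RHS]/(git_val _ p) git_val_add.
  by rewrite fF hH.
- exists (inv_mul F H) => p; rewrite -[RHS]/(git_val _ p) git_val_mul.
  by rewrite fF hH.
Qed.

(** A character of the invariant ring commutes with polynomial expressions; the
    same [F] serves on the variety and on its quotient. *)
Lemma inv_polyfun (I : Type) (T : I -> inv) (g : (I -> K) -> K) : polyfun g ->
  exists F : inv, (forall x, sval F x = g (fun i => sval (T i) x)) /\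
                  (forall p, git_val F p = g (fun i => git_val (T i) p)).
Proof.
elim=> {g} [c|i|f k _ [F [Fx Fp]] _ [H [Hx Hp]]|f k _ [F [Fx Fp]] _ [H [Hx Hp]]].
- by exists (inv_cst c); split=> // p; rewrite git_val_cst.
- by exists (T i).
- exists (inv_add F H); split=> [x|p]; first by rewrite /= Fx Hx.
  by rewrite git_val_add Fp Hp.
- exists (inv_mul F H); split=> [x|p]; first by rewrite /= Fx Hx.
  by rewrite git_val_mul Fp Hp.
Qed.

Lemma git_val_eq (F H : inv) p : sval F =1 sval H -> git_val F p = git_val H p.
Proof.
move=> FH; have [_ D _] := svalP p.
have e : git_val F p = git_val H p + git_val (inv_cst 0) p.
  by apply: D => x; rewrite FH /= addr0.
by rewrite e git_val_cst addr0.
Qed.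

(** The quotient being affine, its regular functions are the invariants. *)
Lemma zclosureP (Z : set Q) p :
  zclosure Z p <->
  forall F, (forall q, Z q -> git_val F q = 0) -> git_val F p = 0.
Proof.
split=> [zp F ZF|H].
  apply: (zp [set q | git_val F q = 0]); split=> //.
  exists [set git_val F]; first by move=> _ ->; apply: git_reg.
  by apply/seteqP; split=> q /= => [Fq _ ->//|/(_ _ erefl)].
move=> Y [[F rF EY]]; rewrite {}EY => ZF f Ff; have [H' Hf] := rF _ Ff.
by rewrite Hf; apply: H => q /ZF /(_ _ Ff); rewrite Hf.
Qed.

End GitPoints.

(** * Traces of words in a pair of matrices *)

Section Words.
Variable K : closedFieldType.

(** Noncommutative polynomials in the two matrices of a pair.  The dimension is
    left out so that one word can be evaluated both on a pair and on its
    composition factors. *)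
Inductive word : Type :=
| WA | WB | WC of K | WAdd of word & word | WMul of word & word.

Fixpoint word_eval (d : nat) (r : mxpair K d) (w : word) : 'M[K]_d :=
  match w with
  | WA => r.1
  | WB => r.2
  | WC c => c%:M
  | WAdd u v => word_eval r u + word_eval r v
  | WMul u v => word_eval r u *m word_eval r v
  end.

Fixpoint word_pow (w : word) (k : nat) : word :=
  if k is k'.+1 then WMul w (word_pow w k') else WC 1.

Definition word_poly (w : word) (p : {poly K}) : word :=
  foldr (fun c acc => WAdd (WC c) (WMul w acc)) (WC 0) p.

Lemma word_eval_conj d (P : 'M[K]_d) (r : mxpair K d) w : P \in unitmx ->
  word_eval (conj_pair P r) w = P *m word_eval r w *m invmx P.
Proof.
move=> uP; elim: w => [||c|u IHu v IHv|u IHu v IHv] //=.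
- by rewrite scalar_mxC mulmxK.
- by rewrite IHu IHv mulmxDr mulmxDl.
- by rewrite IHu IHv !mulmxA mulmxKV.
Qed.

Lemma tr_conj d (P A : 'M[K]_d) : P \in unitmx ->
  \tr (P *m A *m invmx P) = \tr A.
Proof. by move=> uP; rewrite mxtrace_mulC mulKmx. Qed.

Lemma word_eval_block p q (r : mxpair K p) (s : mxpair K q) X Y w : exists Z,
  word_eval ((block_mx r.1 X 0 s.1, block_mx r.2 Y 0 s.2) : mxpair K (p + q)) w =
  block_mx (word_eval r w) Z 0 (word_eval s w).
Proof.
elim: w => [||c|u [Z1 e1] v [Z2 e2]|u [Z1 e1] v [Z2 e2]] /=.
- by exists X.
- by exists Y.
- by exists 0; rewrite -scalar_mx_block.
- by exists (Z1 + Z2); rewrite e1 e2 add_block_mx addr0.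
- exists (word_eval r u *m Z2 + Z1 *m word_eval s v).
  by rewrite e1 e2 mulmx_block !mulmx0 !mul0mx !addr0 add0r.
Qed.

Lemma tr_word_dsum p q (r : mxpair K p) (s : mxpair K q) w :
  \tr (word_eval (dsum r s) w) = \tr (word_eval r w) + \tr (word_eval s w).
Proof.
by have [Z ->] := word_eval_block r s 0 0 w; rewrite mxtrace_block.
Qed.

(** The trace of a word only sees composition factors, because it is additive
    on block triangular pairs and unchanged by conjugation. *)
Lemma tr_word_semisimplification d (r s : mxpair K d) w :
  semisimplification r s -> \tr (word_eval r w) = \tr (word_eval s w).
Proof.
elim=> {d r s} // [p q r r' s s' X Y _ IHr _ IHs|d r r' s s' _ IH [P uP ->] [Q uQ ->]].
  by rewrite tr_word_dsum -IHr -IHs; have [Z ->] := word_eval_block r s X Y w;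
    rewrite mxtrace_block.
by rewrite !word_eval_conj// !tr_conj.
Qed.

Lemma tr_word_S_equivalent d (r s : mxpair K d) w :
  S_equivalent r s -> \tr (word_eval r w) = \tr (word_eval s w).
Proof. by case=> t /tr_word_semisimplification-> /tr_word_semisimplification->. Qed.

Lemma word_eval_poly d (r : mxpair K d) w (Q : 'M_d) (b : 'I_d -> K) p :
  Q \in unitmx -> word_eval r w = Q *m diag_mx (\row_i b i) *m invmx Q ->
  word_eval r (word_poly w p) = Q *m diag_mx (\row_i p.[b i]) *m invmx Q.
Proof.
move=> uQ e; rewrite /word_poly /horner; elim: (polyseq p) => [|c s IH] /=.
  rewrite (_ : diag_mx _ = 0) ?mulmx0 ?mul0mx ?scalemx1 ?raddf0 //.
  by apply/matrixP => i j; rewrite !mxE mul0rn.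
rewrite IH e !mulmxA mulmxKV// -[Q *m _ *m diag_mx _]mulmxA mulmx_diag.
rewrite -[c%:M](mulmxK uQ) -scalar_mxC -mulmxDl -mulmxDr.
congr (_ *m _ *m _); apply/matrixP => i j; rewrite !mxE.
by case: eqP => _; rewrite ?mulr0n ?addr0// !mulr1n addrC mulrC.
Qed.

Definition char1 (V : mxpair K 1) (w : word) : K := word_eval V w 0 0.

Lemma char1_tr V w : \tr (word_eval V w) = char1 V w.
Proof. by rewrite /mxtrace big_ord1. Qed.

Lemma char1_mul V u v : char1 V (WMul u v) = char1 V u * char1 V v.
Proof. by rewrite /char1 /= mxE big_ord1. Qed.

Lemma char1_pow V w k : char1 V (word_pow w k) = char1 V w ^+ k.
Proof.
elim: k => [|k IH]; first by rewrite /char1 /= mxE.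
by rewrite char1_mul IH exprS.
Qed.

Lemma char1_poly V w p : char1 V (word_poly w p) = p.[char1 V w].
Proof.
rewrite /word_poly /horner; elim: (polyseq p) => [|c s IH] /=.
  by rewrite /char1 /= mxE.
by rewrite -IH /char1 /= !mxE big_ord1 /= mulr1n addrC mulrC.
Qed.

End Words.

Section WordInvariants.
Variables (K : closedFieldType) (n m : nat).
Notation repvar := (Defs.repvar K n m).

Lemma reg_word_entry w i j : reg repvar (fun r => word_eval (sval r) w i j).
Proof.
apply/reg_embedded; elim: w i j => [||c|u IHu v IHv|u IHu v IHv] i j /=.
- apply: gen_ext (gen_var _ (lshift _ (mxvec_index i j))) => r.
  by rewrite row_mxEl mxvecE.
- apply: gen_ext (gen_var _ (rshift _ (mxvec_index i j))) => r.
  by rewrite row_mxEr mxvecE.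
- by apply: gen_ext (gen_cst _ (c%:M i j)) => r.
- by apply: gen_ext (gen_add (IHu i j) (IHv i j)) => r; rewrite mxE.
- pose f k (r : {r : mxpair K 3 | is_SL3rep n m r}) :=
    word_eval (sval r) u i k * word_eval (sval r) v k j.
  apply: (@gen_ext _ _ _ _ (fun r => \sum_k f k r)) => [r|].
    by rewrite mxE.
  by apply: gen_sum => k _; apply: gen_mul.
Qed.

Lemma trace_inv_proof w : reg repvar (fun r => \tr (word_eval (sval r) w)) /\
  forall P (r : repvar),
    \tr (word_eval (sval (SL3_act P r)) w) = \tr (word_eval (sval r) w).
Proof.
split=> [|P r] /=.
  apply/reg_embedded; apply: gen_sum => i _; apply/reg_embedded.
  exact: reg_word_entry.
have uP : sval P \in unitmx by rewrite unitmxE (eqP (svalP P)) unitr1.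
by rewrite word_eval_conj// tr_conj.
Qed.

Definition trace_inv w : invariant_fun (@SL3_act K n m) :=
  exist _ _ (trace_inv_proof w).

Lemma trace_inv_charpt w r :
  git_val (trace_inv w) (charpt r) = \tr (word_eval (sval r) w).
Proof. by []. Qed.

End WordInvariants.

(** * Determinant coordinates on matrices of order three *)

Section Order3.

Definition o0 : 'I_3 := @Ordinal 3 0 isT.
Definition o1 : 'I_3 := @Ordinal 3 1 isT.
Definition o2 : 'I_3 := @Ordinal 3 2 isT.

Lemma I3_ind (P : 'I_3 -> Prop) : P o0 -> P o1 -> P o2 -> forall i, P i.
Proof.
move=> P0 P1 P2 [[|[|[|//]]] ilt].
- by rewrite (_ : Ordinal ilt = o0)//; apply: val_inj.
- by rewrite (_ : Ordinal ilt = o1)//; apply: val_inj.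
- by rewrite (_ : Ordinal ilt = o2)//; apply: val_inj.
Qed.

Lemma I3_add : (((o0 + o0)%R = o0) * ((o0 + o1)%R = o1) * ((o0 + o2)%R = o2) *
  ((o1 + o0)%R = o1) * ((o1 + o1)%R = o2) * ((o1 + o2)%R = o0) *
  ((o2 + o0)%R = o2) * ((o2 + o1)%R = o0) * ((o2 + o2)%R = o1))%type.
Proof. by do ![split]; apply: val_inj. Qed.

Lemma I3_opp : (((- o0)%R = o0) * ((- o1)%R = o2) * ((- o2)%R = o1))%type.
Proof. by do ![split]; apply: val_inj. Qed.

Definition I3E := (I3_opp, I3_add).

Lemma big_I3 (R : Type) (idx : R) (op : Monoid.law idx) (F : 'I_3 -> R) :
  \big[op/idx]_i F i = op (op (F o0) (F o1)) (F o2).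
Proof.
rewrite !big_ord_recl big_ord0 Monoid.mulm1 Monoid.mulmA.
by congr (op (op _ _) _); congr F; apply: val_inj.
Qed.

Lemma sum3 (V : nmodType) (F : 'I_3 -> V) : \sum_i F i = F o0 + F o1 + F o2.
Proof. exact: big_I3. Qed.

Lemma prod3 (A : pzRingType) (F : 'I_3 -> A) :
  \prod_i F i = F o0 * F o1 * F o2.
Proof. exact: big_I3. Qed.

(** The six permutations of three letters: the rotations [i |-> i + a] and the
    transpositions [i |-> b - i]. *)
Definition vperm (w : K33_vertex) (i : 'I_3) : 'I_3 :=
  match w with inl a => i + a | inr b => b - i end.

Lemma K33_vertex_ind (P : K33_vertex -> Prop) :
  P (inl o0) -> P (inl o1) -> P (inl o2) ->
  P (inr o0) -> P (inr o1) -> P (inr o2) -> forall w, P w.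
Proof. by move=> ? ? ? ? ? ? [|]; apply: I3_ind. Qed.

Variable K : closedFieldType.
Implicit Types M : 'M[K]_3.

Definition vsign (w : K33_vertex) : K := if w is inl _ then 1 else -1.

Lemma vsign_sq w : vsign w * vsign w = 1.
Proof. by case: w => _ /=; rewrite ?mulrNN mulr1. Qed.

Definition leibniz (w : K33_vertex) M : K := \prod_i M i (vperm w i).

Lemma leibnizE w M :
  leibniz w M = M o0 (vperm w o0) * M o1 (vperm w o1) * M o2 (vperm w o2).
Proof. by rewrite /leibniz prod3. Qed.

Lemma det_leibniz M :
  \det M = \sum_a leibniz (inl a) M - \sum_b leibniz (inr b) M.
Proof.
have [f fE] : exists f : nat -> nat -> K, forall i j, M i j = f i j.
  by exists (fun i j => M (inord i) (inord j)) => i j; rewrite !inord_val.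
rewrite !sum3 !leibnizE /vperm !I3E (expand_det_row _ o0) sum3 /cofactor.
rewrite !(expand_det_row _ 0) !big_ord_recl !big_ord0 /cofactor !det_mx11 !mxE.
rewrite !fE /= /bump /=; ring.
Qed.

(** The coordinates of [M] modulo left and right multiplication by diagonal
    matrices: the six terms of the Leibniz formula, divided by their sum. *)
Definition lcoord (w : K33_vertex) M : K := vsign w * leibniz w M / \det M.

Lemma sum_lcoord M : M \in unitmx -> \sum_w lcoord w M = 1.
Proof.
rewrite unitmxE unitfE big_sumType /lcoord /vsign /= -!mulr_suml -mulrDl => dM.
by rewrite -!mulr_sumr mul1r mulN1r -det_leibniz divff.
Qed.

Lemma prod_lcoord M : \prod_a lcoord (inl a) M + \prod_b lcoord (inr b) M = 0.
Proof. by rewrite !prod3 /lcoord /= !leibnizE /vperm !I3E; ring. Qed.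

(** Cyclic indices absorb the sign of the cofactor. *)
Definition cof M (i j : 'I_3) : K :=
  M (i + o1) (j + o1) * M (i + o2) (j + o2)
  - M (i + o1) (j + o2) * M (i + o2) (j + o1).

Lemma invmx3E M i j : M \in unitmx -> invmx M i j = cof M j i / \det M.
Proof.
move=> uM; have dM := uM; rewrite unitmxE unitfE in dM.
pose N := \matrix_(i, j) cof M j i.
have MN : M *m N = (\det M)%:M.
  apply/matrixP; move: (det_leibniz M).
  rewrite !sum3 !leibnizE /vperm !I3E => dE.
  by apply: I3_ind; apply: I3_ind; rewrite !mxE sum3 !mxE /cof !I3E /=
    ?mulr1n ?mulr0n ?dE; ring.
have -> : invmx M = (\det M)^-1 *: N.
  by rewrite -[N](mulKmx uM) MN mul_mx_scalar scalerA mulVf// scale1r.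
by rewrite !mxE mulrC.
Qed.

(** Jacobi's identity: the minor of the inverse that appears on the left is, up
    to sign, the entry of [M] in the last row selected by the permutation,
    divided by the determinant. *)
Lemma lcoord_minor w M : M \in unitmx ->
  let N := invmx M in
  M o0 (vperm w o0) * N (vperm w o0) o0 *
    (M o1 (vperm w o1) * N (vperm w o1) o1) -
  M o0 (vperm w o0) * N (vperm w o0) o1 *
    (M o1 (vperm w o1) * N (vperm w o1) o0) = lcoord w M.
Proof.
move=> uM N; have dM := uM; rewrite unitmxE unitfE in dM.
have jacobi : cof M o0 (vperm w o0) * cof M o1 (vperm w o1) -
    cof M o1 (vperm w o0) * cof M o0 (vperm w o1) =
    vsign w * M o2 (vperm w o2) * \det M.
  rewrite det_leibniz !sum3 !leibnizE /vsign /cof.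
  by move: w; apply: K33_vertex_ind; rewrite /vperm !I3E; ring.
rewrite /N !invmx3E// /lcoord leibnizE.
apply: (@etrans _ _ (M o0 (vperm w o0) * M o1 (vperm w o1) *
  (cof M o0 (vperm w o0) * cof M o1 (vperm w o1) -
   cof M o1 (vperm w o0) * cof M o0 (vperm w o1)) / (\det M) ^+ 2)).
  by field.
by rewrite jacobi; field.
Qed.

(** The cofactor of an entry collects the two permutations through it. *)
Lemma entry_inv_lcoord M i j : M \in unitmx ->
  M i j * invmx M j i = lcoord (inl (j - i)) M + lcoord (inr (i + j)) M.
Proof.
move=> uM; have dM := uM; rewrite unitmxE unitfE in dM.
rewrite invmx3E// /lcoord /cof !leibnizE.
by move: i j; apply: I3_ind; apply: I3_ind; rewrite /vperm !I3E /=; field.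
Qed.

End Order3.

(** * Invariants of pairs with prescribed eigenvalues *)

Section EigenPairs.
Variable K : closedFieldType.

Definition lagrange_poly d (a : 'I_d -> K) i : {poly K} :=
  \prod_(k | k != i) ((a i - a k)^-1 *: ('X - (a k)%:P)).

Lemma horner_lagrange d (a : 'I_d -> K) i j : injective a ->
  (lagrange_poly a i).[a j] = (j == i)%:R.
Proof.
move=> ia; rewrite /lagrange_poly horner_prod; case: (eqVneq j i) => [->|ji].
  apply: big1 => k ki; rewrite hornerZ !hornerE mulVf// subr_eq0.
  by rewrite (inj_eq ia) eq_sym.
by rewrite (bigD1 j)//= hornerZ !hornerE subrr mulr0 mul0r.
Qed.

Definition rootpoly d (a : 'I_d -> K) : {poly K} := \prod_k ('X - (a k)%:P).

Lemma rootpolyP d (a : 'I_d -> K) x :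
  reflect (exists k, x = a k) (root (rootpoly a) x).
Proof.
rewrite /root /rootpoly horner_prod; apply: (iffP idP) => [|[k ->]].
  rewrite prodf_seq_eq0 => /hasP[k _ /=]; rewrite !hornerE subr_eq0 => /eqP->.
  by exists k.
by rewrite (bigD1 k)//= !hornerE subrr mul0r.
Qed.

(** The pair with eigenvectors the standard basis and the columns of [M]. *)
Definition eigpair d (a : 'I_d -> K) (M : 'M[K]_d) (b : 'I_d -> K) :
  mxpair K d := (diag_mx (\row_i a i), M *m diag_mx (\row_j b j) *m invmx M).

Variables (d : nat) (a b : 'I_d -> K) (M : 'M[K]_d).
Hypotheses (ia : injective a) (ib : injective b) (uM : M \in unitmx).
Notation r := (eigpair a M b).

(** Evaluated on [eigpair a M b], these words are the spectral projectors. *)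
Definition word_P i := word_poly (WA K) (lagrange_poly a i).
Definition word_Q j := word_poly (WB K) (lagrange_poly b j).
Definition word_PQ i j := WMul (word_P i) (word_Q j).

Lemma word_A_poly p : word_eval r (word_poly (WA K) p) = diag_mx (\row_i p.[a i]).
Proof.
by rewrite (@word_eval_poly _ _ _ _ 1%:M a) ?unitmx1// invmx1 mulmx1 mul1mx.
Qed.

Lemma word_B_poly p :
  word_eval r (word_poly (WB K) p) = M *m diag_mx (\row_i p.[b i]) *m invmx M.
Proof. exact: word_eval_poly. Qed.

Lemma diag_delta (c : 'I_d -> K) i : injective c ->
  diag_mx (\row_k (lagrange_poly c i).[c k]) = delta_mx i i.
Proof.
move=> ic; apply/matrixP => k l; rewrite !mxE horner_lagrange//.
by case: (eqVneq k l) => [->|kl]; rewrite -?mulnb ?mulr1n ?mulr0n;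
  case: (eqVneq _ i) => [E|_]; rewrite ?andbF ?mulr0//= -?E ?eqxx//
    eq_sym (negPf kl).
Qed.

Lemma delta_mulE (A : 'M[K]_d) i k l :
  (delta_mx i i *m A) k l = (k == i)%:R * A i l.
Proof.
rewrite mxE (bigD1 i)//= mxE eqxx andbT big1 ?addr0// => q qi.
by rewrite mxE (negPf qi) andbF mul0r.
Qed.

Lemma word_PQ_entry i j k l :
  word_eval r (word_PQ i j) k l = (k == i)%:R * (M i j * invmx M j l).
Proof.
rewrite /= word_A_poly word_B_poly !diag_delta// delta_mulE -mulmxA mxE.
rewrite (bigD1 j)//= delta_mulE eqxx mul1r big1 ?addr0// => q qj.
by rewrite delta_mulE (negPf qj) mul0r mulr0.
Qed.

Lemma tr_PQ i j : \tr (word_eval r (word_PQ i j)) = M i j * invmx M j i.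
Proof.
rewrite /mxtrace (bigD1 i)//= word_PQ_entry eqxx mul1r big1 ?addr0// => k ki.
by rewrite word_PQ_entry (negPf ki) mul0r.
Qed.

Lemma tr_PQPQ i j k l : \tr (word_eval r (WMul (word_PQ i j) (word_PQ k l))) =
  M i j * invmx M j k * (M k l * invmx M l i).
Proof.
rewrite /mxtrace (bigD1 i)//= big1 ?addr0 => [|p pi].
  rewrite mxE (bigD1 k)//= !word_PQ_entry !eqxx !mul1r big1 ?addr0// => q qk.
  by rewrite !word_PQ_entry (negPf qk) mul0r mulr0.
by rewrite mxE big1// => q _; rewrite !word_PQ_entry (negPf pi) !mul0r.
Qed.

Lemma word_rootA : word_eval r (word_poly (WA K) (rootpoly a)) = 0.
Proof.
rewrite word_A_poly; apply/matrixP => i j; rewrite !mxE.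
have /rootP-> : root (rootpoly a) (a i) by apply/rootpolyP; exists i.
by rewrite mul0rn.
Qed.

Lemma word_rootB : word_eval r (word_poly (WB K) (rootpoly b)) = 0.
Proof.
rewrite word_B_poly (_ : diag_mx _ = 0) ?mulmx0 ?mul0mx//.
apply/matrixP => i j; rewrite !mxE.
have /rootP-> : root (rootpoly b) (b i) by apply/rootpolyP; exists i.
by rewrite mul0rn.
Qed.

End EigenPairs.

Section Coordinates.
Variables (K : closedFieldType) (n m : nat) (tau : component_type K n m).

Lemma subalgebra_repvar : subalgebra (reg (repvar K n m)).
Proof. exact: subalgebra_embedded. Qed.

Lemma subalgebra_GL3 : subalgebra (reg (GL3 K)).
Proof. exact: subalgebra_embedded. Qed.

Notation algR := subalgebra_repvar.

Definition trPQ i j : invariant_fun (@SL3_act K n m) :=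
  trace_inv n m (word_PQ (eps tau) (veps tau) i j).

(** By Jacobi's identity this combination of traces restricts to the
    coordinate [lcoord w] on the pairs [rho tau M]. *)
Definition lcoord_inv (w : K33_vertex) : invariant_fun (@SL3_act K n m) :=
  inv_add algR (inv_mul algR (trPQ o0 (vperm w o0)) (trPQ o1 (vperm w o1)))
    (inv_mul algR (inv_cst _ algR (-1))
      (trace_inv n m (WMul (word_PQ (eps tau) (veps tau) o0 (vperm w o0))
                     (word_PQ (eps tau) (veps tau) o1 (vperm w o1))))).

Lemma trPQ_rho i j M : sval (trPQ i j) (rho tau M) =
  sval M i j * invmx (sval M) j i.
Proof. exact: (tr_PQ (eps_inj (c:=tau)) (veps_inj (c:=tau)) (svalP M)). Qed.

Lemma lcoord_inv_rho w M : sval (lcoord_inv w) (rho tau M) = lcoord w (sval M).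
Proof.
have uM := svalP M.
have -> : sval (lcoord_inv w) (rho tau M) =
    sval (trPQ o0 (vperm w o0)) (rho tau M) * sval (trPQ o1 (vperm w o1)) (rho tau M)
    + -1 * \tr (word_eval (eigpair (eps tau) (sval M) (veps tau))
        (WMul (word_PQ (eps tau) (veps tau) o0 (vperm w o0))
              (word_PQ (eps tau) (veps tau) o1 (vperm w o1)))) by [].
rewrite !trPQ_rho tr_PQPQ ?mulN1r ?lcoord_minor//; first exact: eps_inj.
exact: veps_inj.
Qed.

End Coordinates.

(** * Torus invariants on the general linear group *)

Section TorusInvariants.
Variable K : numClosedFieldType.

Definition exponents := 'I_3 -> 'I_3 -> nat.
Definition mono (e : exponents) (M : 'M[K]_3) : K := \prod_i \prod_j M i j ^+ e i j.
Definition peval (l : seq (K * exponents)) M := \sum_(t <- l) t.1 * mono t.2 M.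

Definition GL3_entry (p : 'I_3 * 'I_3) (M : GL3 K) : K := sval M p.1 p.2.

Lemma mono0 M : mono (fun _ _ => 0%N) M = 1.
Proof. by rewrite /mono big1// => i _; rewrite big1. Qed.

Lemma monoD e e' M :
  mono (fun i j => (e i j + e' i j)%N) M = mono e M * mono e' M.
Proof.
rewrite /mono -big_split; apply: eq_bigr => i _; rewrite -big_split.
by apply: eq_bigr => j _; rewrite exprD.
Qed.

Lemma peval_gen (Q : GL3 K -> K) : gen GL3_entry Q ->
  exists l, forall M, Q M = peval l (sval M).
Proof.
elim=> {Q} [c|[i j]|f h _ [k kE] _ [l lE]|f h _ [k kE] _ [l lE]].
- exists [:: (c, fun _ _ => 0%N)] => M.
  by rewrite /peval big_seq1 /= mono0 mulr1.
- exists [:: (1, fun k l => ((k == i) && (l == j) : nat))] => M /=.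
  rewrite /peval big_seq1 /= mul1r /mono (bigD1 i)//= (bigD1 j)//= !eqxx expr1.
  rewrite big1 => [|q qj]; last by rewrite (negPf qj) andbF.
  rewrite big1 ?mulr1// => q qi; rewrite big1// => p _.
  by rewrite (negPf qi).
- by exists (k ++ l) => M; rewrite kE lE /peval big_cat.
- exists [seq (s.1 * t.1, (fun i j => s.2 i j + t.2 i j)%N) | s <- k, t <- l].
  move=> M; rewrite kE lE /peval big_allpairs_dep big_distrl /=.
  apply: eq_bigr => s _; rewrite big_distrr; apply: eq_bigr => t _ /=.
  by rewrite monoD; ring.
Qed.

Lemma gen_det : gen GL3_entry (fun M => \det (sval M)).
Proof.
apply: (@gen_ext _ _ _ _ (fun M : GL3 K =>
  \sum_a leibniz (inl a) (sval M) - \sum_b leibniz (inr b) (sval M))) => [M|].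
  by rewrite det_leibniz.
have gpm w : gen GL3_entry (fun M : GL3 K => leibniz w (sval M)).
  by apply: gen_prod => i _; exact: (gen_var GL3_entry (i, vperm w i)).
by apply: gen_sub; apply: gen_sum => i _.
Qed.

Lemma GL3_det_neq0 (M : GL3 K) : \det (sval M) != 0.
Proof. by have := svalP M; rewrite unitmxE unitfE. Qed.

Lemma reg_GL3_clear (f : GL3 K -> K) : reg (GL3 K) f ->
  exists N l, forall M, f M * \det (sval M) ^+ N = peval l (sval M).
Proof.
move=> /reg_embedded rf.
suff [N [Q gQ fQ]] : exists N, exists2 Q,
    gen GL3_entry Q & forall M, f M * \det (sval M) ^+ N = Q M.
  by have [l lE] := peval_gen gQ; exists N, l => M; rewrite fQ lE.
elim: rf => {f} [c|i|f h _ [k [F gF fF]] _ [l [H gH hH]]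
                 |f h _ [k [F gF fF]] _ [l [H gH hH]]].
- by exists 0%N, (fun=> c) => [|M]; [exact: gen_cst|rewrite mulr1].
- case: (split_ordP i) => j ->; last first.
    exists 1%N, (fun=> 1) => [|M]; first exact: gen_cst.
    by rewrite row_mxEr (ord1 j) mxE eqxx mulr1n mulVf// GL3_det_neq0.
  case/mxvec_indexP: j => p q.
  exists 0%N, (fun M : GL3 K => sval M p q) => [|M].
    exact: (gen_var GL3_entry (p, q)).
  by rewrite row_mxEl mxvecE mulr1.
- exists (k + l)%N, (fun M => F M * \det (sval M) ^+ l +
    H M * \det (sval M) ^+ k) => [|M].
    by apply: gen_add; apply: gen_mul => //; apply: gen_exp; apply: gen_det.
  by rewrite -fF -hH exprD; ring.
- exists (k + l)%N, (fun M => F M * H M) => [|M]; first exact: gen_mul.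
  by rewrite -fF -hH exprD; ring.
Qed.

Lemma poly_many_roots (p : {poly K}) : (forall s, s != 0 -> p.[s] = 0) -> p = 0.
Proof.
move=> p0; apply/eqP; apply: contraT => pn0.
pose rs := [seq i.+1%:R : K | i <- iota 0 (size p)].
suff : (size rs < size p)%N by rewrite size_map size_iota ltnn.
apply: max_poly_roots => //.
  by apply/allP => _ /mapP[i _ ->]; apply/rootP/p0; rewrite pnatr_eq0.
rewrite map_inj_uniq ?iota_uniq// => i j /eqP.
by rewrite eqr_nat => /eqP[].
Qed.

(** Under a one-parameter group both sides become polynomials in the parameter,
    which takes infinitely many values: compare the coefficients of degree
    [N]. *)
Lemma peval_weight (F : GL3 K -> K) l (wt : exponents -> nat) N :
  (forall M, F M = peval l (sval M)) ->
  (forall s, s != 0 -> forall M : GL3 K, exists M' : GL3 K,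
     F M' = s ^+ N * F M /\
     forall e, mono e (sval M') = s ^+ wt e * mono e (sval M)) ->
  forall M, F M = peval [seq t <- l | wt t.2 == N] (sval M).
Proof.
move=> Fl hom M; pose p : {poly K} :=
  \sum_(t <- l) (t.1 * mono t.2 (sval M)) *: 'X^(wt t.2) - F M *: 'X^N.
have /(congr1 (fun q : {poly K} => q`_N)) : p = 0.
  apply: poly_many_roots => s s0; have [M' [FM' mM']] := hom s s0 M.
  rewrite !hornerE mulrC -FM' Fl horner_sum /peval; apply/eqP.
  rewrite subr_eq0; apply/eqP; apply: eq_bigr => t _.
  by rewrite !hornerE mM'; ring.
rewrite coefB coefZ coefXn eqxx mulr1 coef0 coef_sum => /eqP.
rewrite subr_eq0 => /eqP <-; rewrite /peval big_filter [RHS]big_mkcond /=.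
apply: eq_bigr => t _; rewrite coefZ coefXn eq_sym.
by case: eqP; rewrite ?mulr1 ?mulr0.
Qed.

Definition scale1 (s : K) (i : 'I_3) : 'M[K]_3 :=
  diag_mx (\row_k if k == i then s else 1).

Lemma det_scale1 s i : \det (scale1 s i) = s.
Proof.
rewrite det_diag (bigD1 i)//= !mxE eqxx big1 ?mulr1// => k ki.
by rewrite mxE (negPf ki).
Qed.

Lemma scale1_proof s i : s != 0 ->
  is_diag_mx (scale1 s i) && (scale1 s i \in unitmx).
Proof. by move=> s0; rewrite diag_mx_is_diag unitmxE det_scale1 unitfE. Qed.

Lemma diag1_proof : is_diag_mx (1%:M : 'M[K]_3) && (1%:M \in @unitmx K 3).
Proof. by rewrite scalar_mx_is_diag unitmx1. Qed.

Definition diag_scale1 s i (s0 : s != 0) : diagGL3 K :=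
  exist (fun t => is_diag_mx t && (t \in unitmx)) _ (scale1_proof i s0).

Definition diag1 : diagGL3 K :=
  exist (fun t => is_diag_mx t && (t \in unitmx)) _ diag1_proof.

Definition row_weight i (e : exponents) := (\sum_j e i j)%N.
Definition col_weight j (e : exponents) := (\sum_i e i j)%N.

Lemma mono_row s i e M :
  mono e (scale1 s i *m M) = s ^+ row_weight i e * mono e M.
Proof.
rewrite /mono mul_diag_mx (bigD1 i)//= [in RHS](bigD1 i)//= mulrA.
congr (_ * _); last first.
  apply: eq_bigr => k ki; apply: eq_bigr => j _.
  by rewrite !mxE (negPf ki) mul1r.
rewrite /row_weight -prodrXr -big_split; apply: eq_bigr => j _ /=.
by rewrite !mxE eqxx exprMn.
Qed.

Lemma mono_col s j e M :
  mono e (M *m scale1 s j) = s ^+ col_weight j e * mono e M.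
Proof.
rewrite /col_weight -prodrXr /mono -big_split mul_mx_diag.
apply: eq_bigr => i _ /=; rewrite (bigD1 j)//= [in RHS](bigD1 j)//= mulrA.
congr (_ * _); first by rewrite !mxE eqxx exprMn mulrC.
by apply: eq_bigr => k kj; rewrite !mxE (negPf kj) mulr1.
Qed.

(** An instance of Birkhoff's theorem; it allows a permutation matrix to be
    subtracted from the exponents of a monomial. *)
Lemma birkhoff3 (e : exponents) N : (0 < N)%N ->
  (forall i, row_weight i e = N) -> (forall j, col_weight j e = N) ->
  exists w, forall i, (0 < e i (vperm w i))%N.
Proof.
move=> N0 er ec.
have := (er o0, er o1, er o2, (ec o0, ec o1, ec o2)).
rewrite /row_weight /col_weight !sum3 => -[[[r0 r1] r2] [[c0 c1] c2]].
have [/existsP[w /forallP word_P]|] :=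
  boolP [exists w : K33_vertex, [forall i, (0 < e i (vperm w i))%N]].
  by exists w.
rewrite negb_exists => /forallP nw; exfalso.
have nw' w : e o0 (vperm w o0) = 0%N \/ e o1 (vperm w o1) = 0%N \/
    e o2 (vperm w o2) = 0%N.
  case: (posnP (e o0 (vperm w o0))) => [->|h0]; first by left.
  case: (posnP (e o1 (vperm w o1))) => [->|h1]; first by right; left.
  case: (posnP (e o2 (vperm w o2))) => [->|h2]; first by right; right.
  by case/negP: (nw w); apply/forallP; apply: I3_ind.
have := (nw' (inl o0), nw' (inl o1), nw' (inl o2),
         (nw' (inr o0), nw' (inr o1), nw' (inr o2))).
rewrite /vperm !I3E; clear nw nw' er ec => -[[[h0 h1] h2] [[h3 h4] h5]].
move: (e o0 o0) (e o0 o1) (e o0 o2) (e o1 o0) (e o1 o1) (e o1 o2) (e o2 o0)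
  (e o2 o1) (e o2 o2) r0 r1 r2 c0 c1 c2 h0 h1 h2 h3 h4 h5.
lia.
Qed.

(** Peel off permutation matrices from the exponents one at a time. *)
Lemma gen_lcoord_mono N e :
  (forall i, row_weight i e = N) -> (forall j, col_weight j e = N) ->
  gen (fun w (M : GL3 K) => lcoord w (sval M))
      (fun M => mono e (sval M) / \det (sval M) ^+ N).
Proof.
elim: N e => [|N IH] e er ec.
  apply: gen_ext (gen_cst _ 1) => M; rewrite divr1 /mono big1// => i _.
  rewrite big1// => j _.
  have : (e i j <= row_weight i e)%N by rewrite /row_weight (bigD1 j)//= leq_addr.
  by rewrite er leqn0 => /eqP->.
have [w ew] := birkhoff3 (ltn0Sn N) er ec.
pose e' : exponents := fun i j => (e i j - (j == vperm w i))%N.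
have eE i j : e i j = (e' i j + (j == vperm w i))%N.
  by rewrite /e' subnK//; case: eqP => // ->.
have gu : gen (fun w (M : GL3 K) => lcoord w (sval M))
    (fun M => leibniz w (sval M) / \det (sval M)).
  apply: gen_ext (gen_mul (gen_cst _ (vsign K w))
    (gen_var (fun w (M : GL3 K) => lcoord w (sval M)) w)) => M.
  by rewrite /lcoord !mulrA vsign_sq mul1r.
have row_sg i : (\sum_j (j == vperm w i) = 1)%N.
  by rewrite (bigD1 (vperm w i))//= eqxx big1// => j /negPf->.
have col_sg j : (\sum_i (j == vperm w i) = 1)%N.
  by move: w j {ew e' eE gu row_sg}; apply: K33_vertex_ind; apply: I3_ind;
    rewrite sum3 /vperm !I3E.
apply: gen_ext (gen_mul gu (IH e' _ _)) => [M|i|j].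
- have dM := GL3_det_neq0 M; rewrite exprS.
  have -> : mono e (sval M) = leibniz w (sval M) * mono e' (sval M).
    rewrite mulrC -[leibniz _ _]/(\prod_i _) /mono -big_split.
    apply: eq_bigr => i _ /=.
    under eq_bigr do rewrite eE exprD.
    rewrite big_split /=; congr (_ * _).
    by rewrite (bigD1 (vperm w i))//= eqxx expr1 big1 ?mulr1// => j /negPf->.
  by field; rewrite expf_neq0.
- have := er i; rewrite /row_weight.
  under eq_bigr do rewrite eE.
  by rewrite big_split /= row_sg addn1 => -[].
- have := ec j; rewrite /col_weight.
  under eq_bigr do rewrite eE.
  by rewrite big_split /= col_sg addn1 => -[].
Qed.

(** After clearing denominators, an invariant function is a polynomial
    homogeneous of the same degree in every row and in every column. *)
Theorem torus_invariants (f : GL3 K -> K) : reg (GL3 K) f ->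
  (forall h M, f (H_act h M) = f M) ->
  gen (fun w (M : GL3 K) => lcoord w (sval M)) f.
Proof.
move=> rf fH; have [N [l fl]] := reg_GL3_clear rf.
have fT (t : diagGL3 K * diagGL3 K) M : f (TT_act t M) = f M.
  by rewrite -H_actE fH.
pose F (M : GL3 K) := f M * \det (sval M) ^+ N.
have row_filter i k : (forall M, F M = peval k (sval M)) ->
    forall M, F M = peval [seq t <- k | row_weight i t.2 == N] (sval M).
  move=> Fk; apply: (peval_weight Fk) => s s0 M.
  pose t := diag_scale1 i s0.
  exists (TT_act (t, diag1) M); split=> [|e].
    by rewrite /F fT /= mulmx1 det_mulmx det_scale1 exprMn; ring.
  by rewrite /= mulmx1 mono_row.
have col_filter j k : (forall M, F M = peval k (sval M)) ->
    forall M, F M = peval [seq t <- k | col_weight j t.2 == N] (sval M).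
  move=> Fk; apply: (peval_weight Fk) => s s0 M.
  pose t := diag_scale1 j s0.
  exists (TT_act (diag1, t) M); split=> [|e].
    by rewrite /F fT /= mul1mx det_mulmx det_scale1 exprMn; ring.
  by rewrite /= mul1mx mono_col.
have := col_filter o2 _ (col_filter o1 _ (col_filter o0 _
  (row_filter o2 _ (row_filter o1 _ (row_filter o0 _ fl))))).
rewrite -!filter_predI; set P := predI _ _ => FP.
apply: (@gen_ext _ _ _ _ (fun M : GL3 K => \sum_(t <- l | P t)
    t.1 * (mono t.2 (sval M) / \det (sval M) ^+ N))) => [M|].
  have d0 : \det (sval M) ^+ N != 0 by rewrite expf_neq0// GL3_det_neq0.
  rewrite -[RHS](mulfK d0) -[f M * _]/(F M) FP /peval big_filter mulr_suml.
  by apply: eq_bigr => t _; rewrite mulrA.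
apply: gen_sum => t; rewrite /P /= -!andbA.
case/and5P=> /eqP c2 /eqP c1 /eqP c0 /eqP r2 /andP[/eqP r1 /eqP r0].
by apply: gen_mul; [exact: gen_cst|apply: gen_lcoord_mono; apply: I3_ind].
Qed.

End TorusInvariants.

(** * Irreducibility and zero patterns *)

Section Stable.
Variable K : closedFieldType.

Lemma row_neq0 d (M : 'M[K]_d) i : M \in unitmx -> exists j, M i j != 0.
Proof.
move=> uM; apply/existsP; apply: contraT; rewrite negb_exists => /forallP N0.
have /matrixP/(_ i i) := mulmxV uM; rewrite !mxE eqxx big1 => [/eqP|j _].
  by rewrite eq_sym oner_eq0.
by have := N0 j; rewrite negbK => /eqP->; rewrite mul0r.
Qed.

Lemma inv_col_neq0 d (M : 'M[K]_d) i : M \in unitmx ->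
  exists j, invmx M j i != 0.
Proof.
move=> uM; have uT : (invmx M)^T \in unitmx by rewrite unitmx_tr unitmx_inv.
by have [j] := row_neq0 i uT; rewrite mxE; exists j.
Qed.

(** Polynomials in the diagonal matrix preserve the subspace; apply to [v] the
    Lagrange polynomial isolating the entry [a i]. *)
Lemma stable_coord d e (a : 'I_d -> K) (U : 'M[K]_(e, d)) (v : 'rV_d) i :
  injective a -> stablemx U (diag_mx (\row_k a k)) -> (v <= U)%MS ->
  v 0 i != 0 -> ((delta_mx 0 i : 'rV[K]_d) <= U)%MS.
Proof.
move=> ia sU vU vi.
have pU (p : {poly K}) : ((\row_k (v 0 k * p.[a k]))%R <= U)%MS.
  elim/poly_ind: p => [|p c IH].
    rewrite (_ : \row_k _ = 0) ?sub0mx//.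
    by apply/rowP => k; rewrite !mxE hornerE mulr0.
  rewrite (_ : \row_k _ = (\row_k (v 0 k * p.[a k])) *m diag_mx (\row_k a k)
      + c *: v).
    apply: addmx_sub; last exact: scalemx_sub.
    exact: submx_trans (submxMr _ IH) sU.
  by apply/rowP => k; rewrite mul_mx_diag !mxE !hornerE; ring.
have := scalemx_sub (v 0 i)^-1 (pU (lagrange_poly a i)).
congr (_ <= _)%MS; apply/rowP => k; rewrite !mxE horner_lagrange// eqxx /=.
by case: (eqVneq k i) => [->|]; rewrite ?mulr1 ?mulr0 ?mulVf.
Qed.

Variables (d : nat) (a b : 'I_d -> K) (M : 'M[K]_d).
Hypotheses (ia : injective a) (ib : injective b) (uM : M \in unitmx).
Notation r := (eigpair a M b).

Lemma mulmxV_trmx : (M^T *m (invmx M)^T = 1%:M) * ((invmx M)^T *m M^T = 1%:M).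
Proof. by rewrite -!trmx_mul mulVmx// mulmxV// trmx1. Qed.

Section Graph.
Variable U : 'M[K]_d.
Hypotheses (sA : stablemx U r.1^T) (sB : stablemx U r.2^T).

Lemma stable_col i j : ((delta_mx 0 i : 'rV[K]_d) <= U)%MS ->
  invmx M j i != 0 -> ((col j M)^T <= U)%MS.
Proof.
move=> iU Nji; set W := U *m (invmx M)^T.
have sW : stablemx W (diag_mx (\row_k b k)).
  have := submxMr (invmx M)^T sB.
  by rewrite /= !trmx_mul tr_diag_mx !mulmxA -[_ *m M^T *m _]mulmxA
    mulmxV_trmx mulmx1.
have iW : (row i (invmx M)^T <= W)%MS by rewrite rowE submxMr.
have /(stable_coord ib sW iW) : row i (invmx M)^T 0 j != 0 by rewrite !mxE.
move/(submxMr M^T); rewrite -rowE -tr_col => /submx_trans; apply.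
by rewrite /W -mulmxA mulmxV_trmx mulmx1.
Qed.

Lemma stable_row i j : ((col j M)^T <= U)%MS -> M i j != 0 ->
  ((delta_mx 0 i : 'rV[K]_d) <= U)%MS.
Proof.
move=> jU Mij; apply: stable_coord ia _ jU _; last by rewrite !mxE.
by move: sA; rewrite /= tr_diag_mx.
Qed.

Lemma stable_nonzero : U != 0 -> exists i, ((delta_mx 0 i : 'rV[K]_d) <= U)%MS.
Proof.
case/matrix0Pn=> k [i Uki]; exists i.
apply: (stable_coord ia _ (row_sub k U)); last by rewrite mxE.
by move: sA; rewrite /= tr_diag_mx.
Qed.

Lemma stable_full : (forall i, ((delta_mx 0 i : 'rV[K]_d) <= U)%MS) ->
  row_full U.
Proof.
move=> dU; rewrite -sub1mx; apply/row_subP => i.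
by rewrite row1.
Qed.

End Graph.

Lemma irreducible_entries : (0 < d)%N -> (forall i j, M i j != 0) ->
  irreducible_pair r.
Proof.
move=> d0 Mn0; split=> // U sA sB; case: (eqVneq U 0) => [->|Un0]; first by left.
right; apply: stable_full => i; have [k kU] := stable_nonzero sA Un0.
have [j Njk] := inv_col_neq0 k uM.
have iU := stable_row sA (stable_col sB kU Njk) (Mn0 i j); exact: iU.
Qed.

End Stable.

Section ZeroPatterns.
Variable K : closedFieldType.
Implicit Types M : 'M[K]_3.

Lemma card_I3 (P : pred 'I_3) : #|P| = (P o0 + P o1 + P o2)%N.
Proof.
rewrite -sum1_card big_mkcond /= big_I3 /=.
by rewrite -!topredE /=; case: (P o0); case: (P o1); case: (P o2).
Qed.

Lemma I3_third (j k l : 'I_3) : j != k -> [|| l == j, l == k | l == - (j + k)].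
Proof.
by move: j k l; apply: I3_ind; apply: I3_ind; apply: I3_ind; rewrite !I3E.
Qed.

Lemma two_zerosP (f : 'I_3 -> K) :
  #|[pred j | f j == 0]| = 2%N <->
  exists2 l, f l != 0 & forall j, j != l -> f j = 0.
Proof.
rewrite card_I3 /=; split=> [|[l]].
  case: (eqVneq (f o0) 0) => f0; case: (eqVneq (f o1) 0) => f1;
    case: (eqVneq (f o2) 0) => f2 // _;
    [exists o2|exists o1|exists o0] => //; by apply: I3_ind.
by move: l; apply: I3_ind => /negPf-> f0; rewrite !f0// eqxx.
Qed.

Lemma unitmx_row_zeros M i j k : M \in unitmx -> j != k ->
  M i j = 0 -> M i k = 0 -> two_zeros_row M i.
Proof.
move=> uM jk Mij Mik; apply/two_zerosP; have [l Mil] := row_neq0 i uM.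
exists l => // q ql; apply/eqP; apply: contraT => Miq.
have := I3_third l jk; have := I3_third q jk.
by case/or3P=> /eqP e; case/or3P=> /eqP e'; move: Mil Miq ql;
  rewrite e e' ?Mij ?Mik ?eqxx.
Qed.

Lemma unitmx_col_zeros M i j k : M \in unitmx -> j != k ->
  M j i = 0 -> M k i = 0 -> two_zeros_col M i.
Proof.
move=> uM jk Mij Mik; have uT : M^T \in unitmx by rewrite unitmx_tr.
have := @unitmx_row_zeros M^T i j k uT jk; rewrite !mxE => /(_ Mij Mik).
move=> /two_zerosP[l Ml lE]; apply/two_zerosP; exists l; rewrite ?mxE // in Ml *.
by move=> q /lE; rewrite mxE.
Qed.

Section Irreducible.
Variables (a b : 'I_3 -> K) (M : 'M[K]_3).
Hypotheses (ia : injective a) (ib : injective b) (uM : M \in unitmx).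

(** Consider the coordinate vectors and the columns of [M] that lie in a nonzero
    invariant subspace.  Were it proper, some column in it would have two nonzero
    entries, which forces the inverse of [M] to have two proportional columns. *)
Lemma irreducible_no_zero_line :
  ~ zero_line M -> irreducible_pair (eigpair a M b).
Proof.
move=> nz; split=> // U sA sB; case: (eqVneq U 0) => [->|Un0]; first by left.
right; apply: stable_full => i1; apply/negPn/negP => i1U.
have [i0 i0U] := stable_nonzero ia sA Un0.
have [j Nj] := inv_col_neq0 i0 uM.
have jU := stable_col ib uM sB i0U Nj.
have M1j : M i1 j = 0.
  by apply/eqP; apply: contraT => /(stable_row ia sA jU); rewrite (negPf i1U).
have colj i : i != i1 -> M i j != 0.
  move=> ii1; apply/eqP => Mij; apply: nz; right; exists j.
  exact: unitmx_col_zeros ii1 Mij M1j.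
have N0 i k : i != i1 -> k != j -> invmx M k i = 0.
  move=> ii1 kj; apply/eqP; apply: contraT => Nki; case: nz; left; exists i1.
  apply: (unitmx_row_zeros uM kj) => //.
  have iU := stable_row ia sA jU (colj i ii1).
  have kU := stable_col ib uM sB iU Nki.
  by apply/eqP; apply: contraT => /(stable_row ia sA kU); rewrite (negPf i1U).
have MN i k : k != i1 -> M i j * invmx M j k = (i == k)%:R.
  move=> kk1; have /matrixP/(_ i k) := mulmxV uM; rewrite !mxE => <-.
  rewrite (bigD1 j)//= big1 ?addr0// => l lj.
  by rewrite N0// mulr0.
have [h1 h2] : i1 + o1 != i1 /\ i1 + o2 != i1.
  by move: (i1); apply: I3_ind; rewrite !I3E.
have := MN (i1 + o1) (i1 + o2) h2; rewrite (_ : (_ == _) = false); last first.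
  by move: (i1); apply: I3_ind; rewrite !I3E.
have := MN (i1 + o2) (i1 + o2) h2; rewrite eqxx => e /eqP.
rewrite mulf_eq0 (negPf (colj _ h1)) => /eqP e'; move/eqP: e.
by rewrite e' mulr0 eq_sym oner_eq0.
Qed.

Lemma zero_line_reducible :
  zero_line M -> ~ irreducible_pair (eigpair a M b).
Proof.
move=> zl [_ irr].
have delta_not_full i : ~ row_full (delta_mx i i : 'M[K]_3).
  by rewrite /row_full mxrank_delta.
have co_not_full i : ~ row_full (1%:M - delta_mx i i : 'M[K]_3).
  rewrite row_full_unit => uD.
  have : delta_mx i i *m (1%:M - delta_mx i i) = 0 :> 'M[K]_3.
    by rewrite mulmxBr mulmx1 mul_delta_mx subrr.
  move/(congr1 (mulmx^~ (invmx (1%:M - delta_mx i i)))).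
  rewrite mulmxK// mul0mx => /matrixP/(_ i i); rewrite !mxE !eqxx => /eqP.
  by rewrite oner_eq0.
have delta_neq0 i : delta_mx i i <> 0 :> 'M[K]_3.
  by move=> /matrixP/(_ i i); rewrite !mxE !eqxx => /eqP; rewrite oner_eq0.
have co_neq0 i : 1%:M - delta_mx i i <> 0 :> 'M[K]_3.
  move=> /matrixP/(_ (i + o1) (i + o1)); rewrite !mxE !eqxx.
  rewrite (_ : (i + o1 == i) = false) ?subr0 => [/eqP|]; rewrite ?oner_eq0//.
  by move: (i); apply: I3_ind; rewrite !I3E.
have BM : (eigpair a M b).2 *m M = M *m diag_mx (\row_j b j).
  by rewrite /= mulmxKV.
case: zl => -[i /two_zerosP[l Ml lE]].
- case: (irr (1%:M - delta_mx i i)) => [||/co_neq0|/co_not_full]//.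
    rewrite /= tr_diag_mx mulmxBl mul1mx; apply/submxP.
    exists (diag_mx (\row_k a k)); rewrite mulmxBr mulmx1; congr (_ - _).
    rewrite mul_mx_diag mul_diag_mx; apply/matrixP => p q; rewrite !mxE.
    case: (eqVneq p i) => [->|_]; rewrite ?mul0r ?mulr0//=.
    by case: (eqVneq q i) => [->|_]; rewrite ?mul0r ?mulr0// mulrC.
  set B := (eigpair a M b).2.
  have Bi k : k != i -> B i k = 0.
    move=> ki; have /matrixP eN := mulmxV uM.
    have Nl : invmx M l k = 0.
      have := eN i k; rewrite !mxE (bigD1 l)//= big1 ?addr0 => [|q ql].
        rewrite eq_sym (negPf ki) => /eqP; rewrite mulf_eq0 (negPf Ml).
        by move/eqP.
      by rewrite lE// mul0r.
    rewrite /B /= mul_mx_diag mxE (bigD1 l)//= Nl mulr0 big1 ?addr0// => q ql.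
    by rewrite mxE lE// !mul0r.
  clearbody B; apply/submxP; exists ((1%:M - delta_mx i i) *m B^T).
  rewrite mulmxBr mulmx1 -[LHS]subr0; congr (_ - _).
  apply/esym/matrixP => p q; rewrite [RHS]mxE mxE big1// => k _.
  rewrite [X in _ * X]mxE; case: (eqVneq k i) => [->|_]; last by rewrite mulr0.
  rewrite mxE big1 ?mul0r// => k' _; rewrite !mxE.
  case: (eqVneq k' i) => [->|k'i]; last by rewrite Bi ?mulr0.
  by rewrite andbT subrr mul0r.
- case: (irr (delta_mx l l)) => [||/delta_neq0|/delta_not_full]//.
    rewrite /= tr_diag_mx; apply/submxP; exists (diag_mx (\row_k a k)).
    rewrite mul_mx_diag mul_diag_mx; apply/matrixP => p q; rewrite !mxE.
    case: (eqVneq p l) => [->|_]; rewrite ?mul0r ?mulr0//=.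
    by case: (eqVneq q l) => [->|_]; rewrite ?mul0r ?mulr0// mulrC.
  move: BM; set B := (eigpair a M b).2; clearbody B => BM.
  have Bl k : B k l = (k == l)%:R * b i.
    have /matrixP/(_ k i) := BM; rewrite -/B mul_mx_diag !mxE.
    rewrite (bigD1 l)//= big1 ?addr0 => [e|q ql]; last by rewrite lE ?mulr0.
    apply: (mulIf Ml); rewrite /= e; case: (eqVneq k l) => [->|kl] /=.
      by rewrite mul1r mulrC.
    by rewrite lE// !mul0r.
  apply/submxP; exists ((b i)%:M); rewrite mul_scalar_mx.
  apply/matrixP => p q; rewrite delta_mulE !mxE Bl.
  by case: (eqVneq p l) => _; rewrite ?mul0r ?mulr0// mul1r mulrC.
Qed.

End Irreducible.
End ZeroPatterns.

(** * The closure of a component *)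

Lemma invmx_mul (R : comUnitRingType) (d : nat) (A B : 'M[R]_d) :
  A \in unitmx -> B \in unitmx ->
  invmx (A *m B) = invmx B *m invmx A.
Proof.
move=> uA uB; have uAB : A *m B \in unitmx by rewrite unitmx_mul uA.
rewrite -[LHS](mulmxK uA) -[_ *m A](mulmxK uB) -(mulmxA _ A B).
by rewrite mulVmx// mul1mx.
Qed.

Section Conjugation.
Variables (K : numClosedFieldType) (n m : nat).

(** Dividing by a cube root of the determinant brings it to one without changing
    the conjugation. *)
Lemma charpt_conj (P : 'M[K]_3) (r s : repvar K n m) : P \in unitmx ->
  sval s = conj_pair P (sval r) -> charpt s = charpt r.
Proof.
move=> uP sE; pose c := (3.-root (\det P))^-1.
have d0 : \det P != 0 by rewrite -unitfE -unitmxE.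
have c0 : c != 0 by rewrite invr_eq0 rootC_eq0.
have detcP : \det (c *: P) == 1.
  by rewrite detZ /c exprVn rootCK// mulVf.
pose Q : SL3 K := exist (fun P : 'M[K]_3 => \det P == 1) _ detcP.
have -> : s = SL3_act Q r.
  apply: val_inj; rewrite /= sE /conj_pair.
  have ucP : c *: P \in unitmx by rewrite unitmxE (eqP detcP) unitr1.
  by rewrite invmxZ// -!scalemxAl -!scalemxAr !scalerA ?mulVf ?mulfV// !scale1r.
exact: git_piP.
Qed.

End Conjugation.

Section Closure.
Variables (K : numClosedFieldType) (n m : nat) (tau : component_type K n m).
Notation rho := (rho tau).
Notation comp := (component tau).
Notation algR := (@subalgebra_repvar K n m).

Lemma reg_entry i j : reg (GL3 K) (fun M => sval M i j).
Proof.
apply/reg_embedded; apply: gen_ext (gen_var _ (lshift _ (mxvec_index i j))) => M.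
by rewrite row_mxEl mxvecE.
Qed.

Lemma reg_detV : reg (GL3 K) (fun M => (\det (sval M))^-1).
Proof.
apply/reg_embedded; apply: gen_ext (gen_var _ (rshift _ 0)) => M.
by rewrite row_mxEr mxE eqxx mulr1n.
Qed.

Lemma reg_inv i j : reg (GL3 K) (fun M => invmx (sval M) i j).
Proof.
apply/reg_embedded; apply: (@gen_ext _ _ _ _ (fun M : {M : 'M[K]_3 | M \in unitmx}
  => cof (sval M) j i * (\det (sval M))^-1)) => [M|].
  by rewrite invmx3E// (svalP M).
apply: gen_mul; last by apply/reg_embedded; apply: reg_detV.
by apply: gen_sub; apply: gen_mul; apply/reg_embedded; apply: reg_entry.
Qed.

Lemma reg_pull (F : repvar K n m -> K) : reg (repvar K n m) F ->
  reg (GL3 K) (F \o rho).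
Proof.
move=> /reg_embedded /(gen_comp rho).
apply: gen_subalgebra (subalgebra_GL3 K) _ => i; apply/reg_embedded.
case: (split_ordP i) => {}i ->; case/mxvec_indexP: i => p q.
  apply: gen_ext (gen_cst _ (diag_mx (\row_i eps tau i) p q)) => M /=.
  by rewrite row_mxEl mxvecE.
apply: (@gen_ext _ _ _ _ (fun M : {M : 'M[K]_3 | M \in unitmx} =>
  \sum_k sval M p k * veps tau k * invmx (sval M) k q)) => [M|].
  rewrite /= row_mxEr mxvecE /= mul_mx_diag mxE; apply: eq_bigr => k _.
  by rewrite !mxE.
apply: gen_sum => k _; apply: gen_mul; last first.
  by apply/reg_embedded; apply: reg_inv.
by apply: gen_mul; [apply/reg_embedded; apply: reg_entry|exact: gen_cst].
Qed.

Lemma diag_comm (t : diagGL3 K) (a : 'rV_3) :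
  sval t *m diag_mx a = diag_mx a *m sval t.
Proof.
case/andP: (svalP t) => /is_diag_mxP dt _; rewrite mul_mx_diag mul_diag_mx.
apply/matrixP => i j; rewrite !mxE.
case: (eqVneq i j) => [->|ij]; first exact: mulrC.
by rewrite (dt i j ij) mulr0 mul0r.
Qed.

(** Diagonal matrices commute: the right factor cancels in the second matrix of
    the pair, and conjugation by the left one fixes the first. *)
Lemma rho_TT (t : diagGL3 K * diagGL3 K) (M : GL3 K) :
  sval (rho (TT_act t M)) = conj_pair (sval t.1) (sval (rho M)).
Proof.
case/andP: (svalP t.1) => _ u1; case/andP: (svalP t.2) => _ u2.
have uM := svalP M.
rewrite /= /rho_pair /conj_pair /= diag_comm mulmxK//; congr (_, _).
rewrite !invmx_mul ?unitmx_mul ?u1 ?u2 ?uM// !mulmxA.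
by rewrite -[_ *m sval t.2 *m diag_mx _]mulmxA diag_comm !mulmxA mulmxK.
Qed.

Lemma charpt_rho_TT t M : charpt (rho (TT_act t M)) = charpt (rho M).
Proof.
by case/andP: (svalP t.1) => _ u1; apply: charpt_conj u1 (rho_TT t M).
Qed.

Lemma pull_proof (F : invariant_fun (@SL3_act K n m)) :
  reg (GL3 K) (sval F \o rho) /\
  forall h M, (sval F \o rho) (H_act h M) = (sval F \o rho) M.
Proof.
split=> [|h M]; first exact: reg_pull (svalP F).1.
by rewrite /= -!(git_val_pi F) /H_act -!/(charpt _) charpt_rho_TT.
Qed.

Definition pull (F : invariant_fun (@SL3_act K n m)) :
  invariant_fun (@H_act K) := exist _ _ (pull_proof F).

(** The coordinates [lcoord w] generate the torus invariants, and they are the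
    restrictions of the invariants [lcoord_inv tau w]. *)
Lemma pull_surj (f : GL3 K -> K) : reg (GL3 K) f ->
  (forall h M, f (H_act h M) = f M) ->
  exists2 g, polyfun g &
  exists F : invariant_fun (@SL3_act K n m), (forall M, sval F (rho M) = f M) /\
    forall p, git_val F p = g (fun w => git_val (lcoord_inv tau w) p).
Proof.
move=> rf /(torus_invariants rf)/gen_polyfun[g pg fg]; exists g => //.
have [F [Fx Fp]] := inv_polyfun algR (lcoord_inv tau) pg.
exists F; split=> // M; rewrite Fx fg; congr g; apply/funext => w.
exact: lcoord_inv_rho.
Qed.

(** On the line through [M] in the direction of the matrix with all entries
    equal to one, only finitely many points have a zero entry or a zero
    determinant. *)
Lemma density (f : GL3 K -> K) : reg (GL3 K) f ->
  (forall M : GL3 K, (forall i j, sval M i j != 0) -> f M = 0) ->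
  forall M, f M = 0.
Proof.
move=> rf f0 M.
have [N [l fl]] := reg_GL3_clear rf.
pose L : 'M[{poly K}]_3 := \matrix_(i, j) ('X + (sval M i j)%:P).
pose ev (s : K) : 'M[K]_3 := \matrix_(i, j) (L i j).[s].
pose q : {poly K} := \sum_(t <- l) t.1 *: \prod_i \prod_j L i j ^+ t.2 i j.
have qE s : q.[s] = peval l (ev s).
  rewrite /q horner_sum; apply: eq_bigr => t _; rewrite hornerZ horner_prod.
  congr (_ * _); apply: eq_bigr => i _; rewrite horner_prod.
  by apply: eq_bigr => j _; rewrite horner_exp !mxE.
have dE s : (\det L).[s] = \det (ev s).
  have -> : ev s = map_mx (horner_eval s) L.
    by apply/matrixP => i j; rewrite !mxE.
  by rewrite det_map_mx.
have ev0 : ev 0 = sval M by apply/matrixP => i j; rewrite !mxE !hornerE.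
pose e : {poly K} := \prod_i \prod_j L i j.
have e0 : e != 0.
  apply/prodf_neq0 => i _; apply/prodf_neq0 => j _; rewrite mxE.
  by rewrite -[X in 'X + X]opprK -polyCN polyXsubC_eq0.
have d0 : \det L != 0.
  apply/eqP => L0; have := dE 0; rewrite L0 horner0 ev0 => /esym/eqP.
  by rewrite (negPf (GL3_det_neq0 M)).
have : q * (e * \det L) = 0.
  apply: poly_many_roots => s _; rewrite !hornerM.
  case: (eqVneq e.[s] 0) => [->|es]; first by rewrite mul0r mulr0.
  case: (eqVneq (\det L).[s] 0) => [->|ds]; first by rewrite !mulr0.
  have uev : ev s \in unitmx by rewrite unitmxE unitfE -dE.
  have := fl (exist (fun M : 'M[K]_3 => M \in unitmx) _ uev).
  rewrite f0 ?mul0r => [|i j]; first by rewrite qE => <-; rewrite mul0r.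
  move: es; rewrite /e horner_prod => /prodf_neq0/(_ i isT).
  by rewrite horner_prod => /prodf_neq0/(_ j isT); rewrite /= !mxE.
move/eqP; rewrite !mulf_eq0 (negPf e0) (negPf d0) !orbF => /eqP q0.
have := qE 0; rewrite q0 horner0 ev0 -fl => /esym/eqP.
by rewrite mulf_eq0 expf_eq0 (negPf (GL3_det_neq0 M)) andbF orbF => /eqP.
Qed.

Lemma eigpair_eigenvalue (a b : 'I_3 -> K) (M : 'M[K]_3) : M \in unitmx ->
  (forall i, eigenvalue (eigpair a M b).1 (a i)) /\
  (forall j, eigenvalue (eigpair a M b).2 (b j)).
Proof.
move=> uM; have ediag (c : 'I_3 -> K) i :
    (delta_mx 0 i : 'rV_3) *m diag_mx (\row_k c k) = c i *: delta_mx 0 i.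
  rewrite mul_mx_diag; apply/rowP => k; rewrite !mxE eqxx /=.
  by case: (eqVneq k i) => [->|]; rewrite ?mul0r ?mulr0 // mulrC.
have dn0 i : (delta_mx 0 i : 'rV[K]_3) != 0.
  by apply/eqP => /rowP/(_ i); rewrite !mxE !eqxx => /eqP; rewrite oner_eq0.
split=> i; apply/eigenvalueP.
  by exists (delta_mx 0 i); [exact: ediag|exact: dn0].
exists (delta_mx 0 i *m invmx M).
  by rewrite /= !mulmxA mulmxKV// ediag scalemxAl.
apply/eqP => /(congr1 (mulmx^~ M)); rewrite mulmxKV// mul0mx => /eqP.
by rewrite (negPf (dn0 i)).
Qed.

(** Eigenvectors for distinct eigenvalues are independent: the left kernel of
    the matrix of eigenvectors is stable under the diagonal matrix of the
    eigenvalues, so a nonzero element would put a coordinate vector in it. *)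
Lemma diagonalize (A : 'M[K]_3) (a : 'I_3 -> K) : injective a ->
  (forall i, eigenvalue A (a i)) ->
  exists2 V, V \in unitmx & V *m A *m invmx V = diag_mx (\row_i a i).
Proof.
move=> ia ev; have ev' i : exists v : 'rV_3, v *m A = a i *: v /\ v != 0.
  by have /eigenvalueP[v vA v0] := ev i; exists v.
have [v vP] := choice ev'.
pose V := \matrix_i v i.
have VA : V *m A = diag_mx (\row_i a i) *m V.
  apply/row_matrixP => i; rewrite row_mul rowK (vP i).1 mul_diag_mx.
  by apply/rowP => k; rewrite !mxE.
have uV : V \in unitmx.
  rewrite -row_free_unit -kermx_eq0; apply/eqP.
  apply: contrapT => /eqP/matrix0Pn[k [i kiV]].
  have sV : stablemx (kermx V) (diag_mx (\row_k a k)).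
    by apply/sub_kermxP; rewrite -mulmxA -VA mulmxA mulmx_ker mul0mx.
  have := stable_coord ia sV (row_sub k _) (i := i).
  rewrite mxE => /(_ kiV)/sub_kermxP.
  by rewrite -rowE rowK => /eqP; rewrite (negPf (vP i).2).
by exists V => //; rewrite VA mulmxK.
Qed.

Lemma irreducible_conj d (P : 'M[K]_d) (r : mxpair K d) : P \in unitmx ->
  irreducible_pair r -> irreducible_pair (conj_pair P r).
Proof.
move=> uP [d0 irr]; split=> // U sA sB.
have PV := (mulmxV_trmx uP).
have st (A : 'M[K]_d) : stablemx U (P *m A *m invmx P)^T ->
    stablemx (U *m (invmx P)^T) A^T.
  rewrite !trmx_mul !mulmxA => /(submxMr (invmx P)^T).
  by rewrite -[_ *m P^T *m _]mulmxA PV mulmx1.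
have uPt : (invmx P)^T \in unitmx by rewrite unitmx_tr unitmx_inv.
case: (irr _ (st _ sA) (st _ sB)) => [U0|Uf]; [left|right].
  by rewrite -(mulmxK uPt U) U0 mul0mx.
by move: Uf; rewrite !row_full_unit unitmx_mul => /andP[].
Qed.

(** Diagonalise [A] by [V] and [B] by [W]: the matrix of the pair is then
    [V *m invmx W]. *)
Lemma component_rho p :
  comp p <-> exists2 M, irreducible_pair (sval (rho M)) & p = charpt (rho M).
Proof.
split=> [[r [irr evA evB] <-]|[M irr ->]]; last first.
  exists (rho M) => //; split=> //.
    exact: (eigpair_eigenvalue (eps tau) (veps tau) (svalP M)).1.
  exact: (eigpair_eigenvalue (eps tau) (veps tau) (svalP M)).2.
have [V uV VA] := diagonalize (@eps_inj _ _ _ tau) evA.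
have [W uW WB] := diagonalize (@veps_inj _ _ _ tau) evB.
have uM : V *m invmx W \in unitmx by rewrite unitmx_mul uV unitmx_inv.
pose M : GL3 K := exist (fun M : 'M[K]_3 => M \in unitmx) _ uM.
have E : sval (rho M) = conj_pair V (sval r).
  rewrite /= /rho_pair /conj_pair VA; congr (_, _).
  by rewrite -WB invmx_mul ?unitmx_inv// invmxK !mulmxA mulmxKV// mulmxKV.
exists M; first by rewrite E; apply: irreducible_conj.
by rewrite (charpt_conj uV E).
Qed.

(** Matrices without zero entries give irreducible pairs, and they are dense. *)
Lemma vanish_component F : (forall q, comp q -> git_val F q = 0) ->
  forall M, sval F (rho M) = 0.
Proof.
move=> F0; apply: density (reg_pull (svalP F).1) _ => M Mn0.
apply: (F0 (charpt (rho M))); apply/component_rho; exists M => //.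
by apply: irreducible_entries => //;
  [exact: eps_inj|exact: veps_inj|exact: (svalP M)].
Qed.

Lemma closure_rho M : zclosure comp (charpt (rho M)).
Proof.
apply: (zclosureP _ _).2 => F F0.
exact: vanish_component.
Qed.

(** The difference vanishes on the component, hence on its closure. *)
Lemma closure_val F G p : zclosure comp p ->
  (forall M, sval F (rho M) = sval G (rho M)) -> git_val F p = git_val G p.
Proof.
move=> Zp FG; have cp := (zclosureP _ _).1 Zp.
have := cp (inv_add algR F (inv_mul algR (inv_cst _ algR (-1)) G)).
rewrite git_val_add git_val_mul git_val_cst mulN1r => H; apply/eqP.
rewrite -subr_eq0; apply/eqP; apply: H => q /component_rho[M _ ->].
by rewrite git_val_add git_val_mul git_val_cst mulN1r !git_val_pi FG subrr.
Qed.

Definition lcoord_pt w (p : charvar K n m) : K := git_val (lcoord_inv tau w) p.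

Lemma lcoord_pt_rho w M : lcoord_pt w (charpt (rho M)) = lcoord w (sval M).
Proof. exact: lcoord_inv_rho. Qed.

Lemma closure_polyfun F : exists2 g, polyfun g &
  forall p, zclosure comp p -> git_val F p = g (lcoord_pt^~ p).
Proof.
have [g pg [G [GE gG]]] := pull_surj (pull_proof F).1 (pull_proof F).2.
exists g => // p cp; rewrite -[RHS](gG p).
by apply: closure_val => // M; rewrite GE.
Qed.

Lemma closure_coord p q : zclosure comp p -> zclosure comp q ->
  (forall w, lcoord_pt w p = lcoord_pt w q) -> p = q.
Proof.
move=> cp cq pq; apply: git_ext => F; have [g _ gE] := closure_polyfun F.
by rewrite !gE//; congr g; apply/funext.
Qed.

Lemma closure_relation g p : polyfun g -> zclosure comp p ->
  (forall M : GL3 K, g (fun w => lcoord w (sval M)) = 0) -> g (lcoord_pt^~ p) = 0.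
Proof.
move=> pg cp g0; have [F [Fx Fp]] := inv_polyfun algR (lcoord_inv tau) pg.
rewrite -[LHS](Fp p) -(git_val_cst algR 0 p); apply: closure_val => // M.
by rewrite Fx -[RHS](g0 M); congr g; apply/funext => w; apply: lcoord_inv_rho.
Qed.

End Closure.

Lemma sval_inj (T : Type) (P : T -> Prop) (x y : {x | P x}) :
  sval x = sval y -> x = y.
Proof. by case: x y => [x Px] [y Py] /= xy; apply: eq_exist. Qed.

(** The closure consists of the characters killing the kernel of [pull], and
    [pull] is onto: composition with [pull] and lifting along it are inverse to
    each other. *)
Section ClosureIso.
Variables (K : numClosedFieldType) (n m : nat) (tau : component_type K n m).
Notation comp := (component tau).
Notation clo := (subvariety (zclosure comp)).
Notation inv := (invariant_fun (@SL3_act K n m)).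
Notation invH := (invariant_fun (@H_act K)).

Lemma phi_character (p : GL3_mod_H K) :
  is_character (fun F : inv => git_val (pull tau F) p).
Proof.
have [C D M] := svalP p; split=> [a F Fa|F G H FGH|F G H FGH].
- by apply: C => x; apply: Fa.
- by apply: D => x; apply: FGH.
- by apply: M => x; apply: FGH.
Qed.

Definition phi_charvar (p : GL3_mod_H K) : charvar K n m :=
  exist _ _ (phi_character p).

Lemma phi_closure p : zclosure comp (phi_charvar p).
Proof.
apply: (zclosureP _ _).2 => F F0; have [C _ _] := svalP p.
by apply: C => M; apply: vanish_component.
Qed.

Definition phi (p : GL3_mod_H K) : clo := exist _ _ (phi_closure p).

Lemma phi_GL3pt M : sval (phi (GL3pt M)) = charpt (rho tau M).
Proof. exact: git_ext. Qed.

Lemma lift_ex (f : invH) : exists F : inv, forall M, sval F (rho tau M) = sval f M.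
Proof.
by have [g _ [F [FM _]]] := pull_surj tau (svalP f).1 (svalP f).2; exists F.
Qed.

Definition lift (f : invH) : inv := projT1 (cid (lift_ex f)).

Lemma liftE f M : sval (lift f) (rho tau M) = sval f M.
Proof. exact: (projT2 (cid (lift_ex f))). Qed.

Lemma psi_character (z : clo) :
  is_character (fun f : invH => git_val (lift f) (sval z)).
Proof.
have aR := subalgebra_repvar K n m.
split=> [a f fa|f g h fgh|f g h fgh].
- rewrite -[RHS](git_val_cst aR a (sval z)).
  by apply: closure_val (svalP z) _ => M; rewrite liftE fa.
- rewrite -(git_val_add aR); apply: closure_val (svalP z) _ => M.
  by rewrite /= !liftE fgh.
- rewrite -(git_val_mul aR); apply: closure_val (svalP z) _ => M.
  by rewrite /= !liftE fgh.
Qed.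

Definition psi (z : clo) : GL3_mod_H K := exist _ _ (psi_character z).

Lemma phi_isomorphism : isomorphism phi.
Proof.
split=> [f [g [F gF] fg]|].
  by exists (pull tau F) => p; rewrite /= fg gF.
exists psi; split=> [f [F fF]|p|z].
- by exists (git_val (lift F)) => [|z]; [exact: git_reg|rewrite /= fF].
- apply: git_ext => f; rewrite -[LHS]/(git_val (pull tau (lift f)) p).
  by apply: (git_val_eq (subalgebra_GL3 K)) => M; apply: liftE.
- apply: sval_inj; apply: git_ext => F.
  by apply: closure_val (svalP z) _ => M; rewrite liftE.
Qed.

End ClosureIso.

(** * Realising determinant coordinates *)

Section Realisation.
Variable K : closedFieldType.

Definition mx3 (a b c d e f g h k : K) : 'M[K]_3 := \matrix_(i, j)
  nth 0 (nth [::] [:: [:: a; b; c]; [:: d; e; f]; [:: g; h; k]] i) j.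

Lemma mx3E a b c d e f g h k : let M := mx3 a b c d e f g h k in
  ((M o0 o0 = a) * (M o0 o1 = b) * (M o0 o2 = c) *
   (M o1 o0 = d) * (M o1 o1 = e) * (M o1 o2 = f) *
   (M o2 o0 = g) * (M o2 o1 = h) * (M o2 o2 = k))%type.
Proof. by rewrite /= !mxE. Qed.

(** Cyclic shift of rows and columns moving the corner entry to the unique
    common entry of the permutations [inl e.1] and [inr e.2]. *)
Definition shift_mx (e : K33_edge) (M : 'M[K]_3) : 'M[K]_3 :=
  \matrix_(i, j) M (i - (e.1 - e.2)) (j + (e.1 + e.2)).

Definition shift_vertex (e : K33_edge) (w : K33_vertex) : K33_vertex :=
  match w with inl a => inl (a - e.1) | inr b => inr (b - e.2) end.

Lemma leibniz_shift e w M : leibniz w (shift_mx e M) = leibniz (shift_vertex e w) M.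
Proof.
case: e => a b; rewrite !leibnizE !mxE.
by case: w => w; move: a b w; apply: I3_ind; apply: I3_ind; apply: I3_ind;
  rewrite /vperm /= !I3E; ring.
Qed.

Lemma shift_vertexK e w : shift_vertex (- e.1, - e.2) (shift_vertex e w) = w.
Proof. by case: w => w; rewrite /= opprK subrK. Qed.

(** If no value vanishes, a matrix with four entries equal to one can be solved
    for directly.  Otherwise an even and an odd value vanish: put a zero in the
    entry common to the two permutations; each of the four other terms contains
    an entry of its own, to be chosen freely. *)
Lemma realise_leibniz (v : K33_vertex -> K) :
  \prod_a v (inl a) + \prod_b v (inr b) = 0 ->
  exists M : 'M[K]_3, forall w, vsign K w * leibniz w M = v w.
Proof.
case: (boolP [exists a, v (inl a) == 0]) => [/existsP[a /eqP va] vv|].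
  have [b /eqP vb] : exists b, v (inr b) == 0.
    apply/existsP; apply: contraT; rewrite negb_exists => /forallP vb.
    move: vv; rewrite (bigD1 a)//= va mul0r add0r => /eqP.
    by apply: contraTT => _; apply/prodf_neq0 => b _; apply: vb.
  pose t w := v (shift_vertex (- a, - b) w).
  exists (shift_mx (a, b) (mx3 0 1 1 1 (- t (inr o2)) (t (inl o1))
                               1 (t (inl o2)) (- t (inr o1)))).
  move=> w; rewrite leibniz_shift -[in RHS](shift_vertexK (a, b) w) -/(t _).
  have [ta tb] : t (inl o0) = 0 /\ t (inr o0) = 0.
    by rewrite /t /= !opprK (_ : o0 = 0) ?add0r//; apply: val_inj.
  have -> : vsign K w = vsign K (shift_vertex (a, b) w) by case: (w).
  move: (shift_vertex (a, b) w) => {}w; rewrite leibnizE.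
  by move: w; apply: K33_vertex_ind; rewrite /vperm !I3E !mx3E ?ta ?tb /=; ring.
rewrite negb_exists => /forallP va vv.
have vb b : v (inr b) != 0.
  apply/eqP => vb0; move: vv => /eqP; rewrite addrC.
  rewrite (bigD1 b)//= vb0 mul0r add0r; apply/negP.
  by apply/prodf_neq0 => a _; apply: va.
have := (va o0, va o1, va o2, (vb o0, vb o1, vb o2)) => -[[[a0 a1] a2] [[b0 b1] b2]].
pose x := - v (inl o0) * v (inl o2) / v (inr o2).
pose p := - v (inr o2) / v (inl o2).
pose q := - v (inl o1) / v (inr o1).
exists (mx3 x (- v (inr o1)) (v (inl o2)) 1 p q 1 1 1).
move: vv; rewrite !prod3 => /eqP; rewrite addr_eq0 => /eqP vv.
apply: K33_vertex_ind; rewrite leibnizE /vperm !I3E !mx3E /= /x /p /q.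
- by field; rewrite a2 b2.
- by field.
- by ring.
- have -> : v (inr o0) = - (v (inl o0) * v (inl o1) * v (inl o2)) /
      (v (inr o1) * v (inr o2)) by rewrite vv; field; rewrite b1 b2.
  by field; rewrite b1 b2.
- by ring.
- by field.
Qed.

Lemma realise_lcoord (v : K33_vertex -> K) : \sum_w v w = 1 ->
  \prod_a v (inl a) + \prod_b v (inr b) = 0 ->
  exists2 M : 'M[K]_3, M \in unitmx & forall w, lcoord w M = v w.
Proof.
move=> v1 /realise_leibniz[M Mv]; exists M.
  rewrite unitmxE; suff -> : \det M = 1 by rewrite unitr1.
  rewrite det_leibniz -v1 big_sumType /= -sumrN.
  by congr (_ + _); apply: eq_bigr => i _; rewrite -Mv /= ?mul1r ?mulN1r.
move=> w; rewrite /lcoord Mv; suff -> : \det M = 1 by rewrite divr1.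
rewrite det_leibniz -v1 big_sumType /= -sumrN.
by congr (_ + _); apply: eq_bigr => i _; rewrite -Mv /= ?mul1r ?mulN1r.
Qed.

End Realisation.

Section ClosurePoints.
Variables (K : numClosedFieldType) (n m : nat) (tau : component_type K n m).

Lemma closure_orbit p : zclosure (component tau) p ->
  exists M, p = charpt (rho tau M).
Proof.
move=> cp; have [] := @realise_lcoord K (fun w => lcoord_pt tau w p).
- apply/eqP; rewrite -subr_eq0; apply/eqP.
  apply: (@closure_relation _ _ _ _ (fun v => \sum_w v w - 1)) cp _ => [|M].
    apply: gen_sub; last exact: gen_cst.
    by apply: gen_sum => w _; exact: (gen_var (fun w (v : K33_vertex -> K) => v w)).
  by rewrite sum_lcoord ?subrr// (svalP M).
- apply: (@closure_relation _ _ _ _ (fun v => \prod_a v (inl a) +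
    \prod_b v (inr b))) cp _ => [|M]; last exact: prod_lcoord.
  apply: gen_add; apply: gen_prod => w _.
    exact: (gen_var (fun w (v : K33_vertex -> K) => v w) (inl w)).
  exact: (gen_var (fun w (v : K33_vertex -> K) => v w) (inr w)).
move=> M uM Mu; pose M' : GL3 K := exist (fun M : 'M[K]_3 => M \in unitmx) _ uM.
exists M'; apply: (closure_coord cp (closure_rho M')) => w.
by rewrite lcoord_pt_rho -Mu.
Qed.

End ClosurePoints.

(** * Semisimplifications of reducible pairs *)

Section Semisimple.
Variable K : closedFieldType.

Lemma irreducible1 (r : mxpair K 1) : irreducible_pair r.
Proof.
split=> // U _ _; case: (eqVneq U 0) => [|U0]; [by left|right].
by rewrite /row_full eqn_leq rank_leq_col lt0n mxrank_eq0.
Qed.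

Lemma similar_refl d (r : mxpair K d) : similar_pair r r.
Proof.
exists 1%:M; first exact: unitmx1.
by case: r => A B; rewrite /conj_pair invmx1 !mulmx1 !mul1mx.
Qed.

Lemma similar_conj d (P : 'M[K]_d) (r : mxpair K d) : P \in unitmx ->
  similar_pair (conj_pair P r) r.
Proof.
move=> uP; exists (invmx P); first by rewrite unitmx_inv.
by case: r => A B; rewrite /conj_pair /= invmxK !mulmxA mulVmx// !mul1mx
  !mulmxKV.
Qed.

Lemma semisimplification_conj d (P : 'M[K]_d) (r s : mxpair K d) :
  P \in unitmx -> semisimplification (conj_pair P r) s ->
  semisimplification r s.
Proof.
move=> uP ss; apply: Semisimpl_conj ss _ (similar_refl s).
exact: similar_conj.
Qed.

Lemma semisimplification_dsum p q (r r' : mxpair K p) (s s' : mxpair K q) :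
  semisimplification r r' -> semisimplification s s' ->
  semisimplification (dsum r s) (dsum r' s').
Proof. exact: Semisimpl_ext. Qed.

Definition swap_mx : 'M[K]_3 :=
  (block_mx 0 1%:M 1%:M 0 : 'M[K]_(1 + 2, 2 + 1)).

Lemma dsum_swap (V : mxpair K 2) (W : mxpair K 1) :
  similar_pair (dsum V W : mxpair K 3) (dsum W V : mxpair K 3).
Proof.
pose Q : 'M[K]_3 := (block_mx 0 1%:M 1%:M 0 : 'M[K]_(2 + 1, 1 + 2)).
have PQ : swap_mx *m Q = 1%:M.
  rewrite [LHS](mulmx_block (0 : 'M_(1, 2)) 1%:M 1%:M 0
    (0 : 'M_(2, 1)) 1%:M 1%:M 0).
  by rewrite !mulmx1 !mulmx0 addr0 !add0r addr0 -scalar_mx_block.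
have uP : swap_mx \in unitmx by case/mulmx1_unit: PQ.
exists swap_mx => //.
have com (A : 'M_2) (B : 'M_1) :
    swap_mx *m (block_mx A 0 0 B : 'M_(2 + 1)) =
    (block_mx B 0 0 A : 'M_(1 + 2)) *m swap_mx.
  rewrite [LHS](mulmx_block (0 : 'M_(1, 2)) 1%:M 1%:M 0 A 0 0 B).
  rewrite [RHS](mulmx_block B 0 0 A (0 : 'M_(1, 2)) 1%:M 1%:M 0).
  by rewrite !mulmx1 !mul1mx !mulmx0 !mul0mx !addr0 !add0r.
by rewrite /conj_pair /dsum /= !com !mulmxK.
Qed.

Lemma unitmx_ublock p q (M : 'M[K]_(p + q)) : M \in unitmx ->
  dlsubmx M = 0 -> ulsubmx M \in unitmx /\ drsubmx M \in unitmx.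
Proof.
move=> uM dl; move: uM; rewrite -{1}(submxK M) dl !unitmxE det_ublock.
by rewrite unitrM => /andP.
Qed.

(** A block triangular matrix of eigenvectors gives a block triangular pair
    whose diagonal blocks are of the same kind. *)
Lemma semisimplification_eigpair p q (a b : 'I_(p + q) -> K)
    (M : 'M[K]_(p + q)) r s : M \in unitmx -> dlsubmx M = 0 ->
  semisimplification
    (eigpair (a \o lshift q) (ulsubmx M) (b \o lshift q)) r ->
  semisimplification
    (eigpair (a \o @rshift p q) (drsubmx M) (b \o @rshift p q)) s ->
  semisimplification (eigpair a M b) (dsum r s).
Proof.
move=> uM dl ssr sss; have [uN uX] := unitmx_ublock uM dl.
set N := ulsubmx M in uN ssr *; set X := drsubmx M in uX sss *.
have diag_block (c : 'I_(p + q) -> K) : diag_mx (\row_i c i) =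
    block_mx (diag_mx (\row_i (c \o lshift q) i)) 0 0
             (diag_mx (\row_i (c \o @rshift p q) i)).
  rewrite -diag_mx_row; congr diag_mx; apply/rowP => i.
  by rewrite !mxE; case: (split_ordP i) => j ->; rewrite mxE.
pose C := ursubmx M.
have ME : M = block_mx N C 0 X by rewrite -[LHS]submxK dl.
have MV : invmx M = block_mx (invmx N) (- (invmx N *m C *m invmx X)) 0 (invmx X).
  set J := block_mx _ _ _ _.
  have MJ : M *m J = 1%:M.
    rewrite ME mulmx_block !mulmx0 !mul0mx !addr0 add0r !mulmxV// mulmxN.
    by rewrite !mulmxA mulmxV// mul1mx addNr -scalar_mx_block.
  by rewrite -[RHS](mulKmx uM) MJ mulmx1.
have := Semisimpl_ext 0 (N *m diag_mx (\row_i (b \o lshift q) i) *m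
   (- (invmx N *m C *m invmx X)) + C *m diag_mx (\row_i (b \o @rshift p q) i)
   *m invmx X) ssr sss.
congr semisimplification; rewrite /eigpair diag_block MV ME diag_block.
by rewrite !mulmx_block !mulmx0 !mul0mx !addr0 !add0r !mul0mx add0r.
Qed.

(** Reordering the eigenvectors conjugates the pair by a permutation matrix. *)
Lemma eigpair_perm d (a b : 'I_d -> K) (M : 'M[K]_d) (s t : 'S_d) :
  M \in unitmx ->
  conj_pair (perm_mx s) (eigpair a M b) =
  eigpair (a \o s) (row_perm s (col_perm t M)) (b \o t).
Proof.
move=> uM; have diag_perm (c : 'I_d -> K) (w : 'S_d) :
    diag_mx (\row_i (c \o w) i) = perm_mx w *m diag_mx (\row_i c i) *m
      invmx (perm_mx w).
  apply: (canRL (mulmxK (unitmx_perm _ w))).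
  rewrite -row_permE mul_diag_mx; apply/matrixP => i j; rewrite !mxE.
  by rewrite mulr_natr.
have uP := unitmx_perm K s; have uQ := unitmx_perm K t.
rewrite /eigpair /conj_pair /= diag_perm; congr (_, _).
have tV : perm_mx (t^-1)%g = invmx (perm_mx t) :> 'M[K]_d.
  by rewrite -[LHS](mulKmx uQ) -perm_mxM mulgV perm_mx1 mulmx1.
rewrite diag_perm row_permE col_permE tV.
rewrite !invmx_mul ?unitmx_mul ?unitmx_inv ?uP ?uM ?uQ// invmxK !mulmxA.
by rewrite !mulmxKV.
Qed.

Lemma perm_ends (i k : 'I_3) : k != i ->
  exists s : 'S_3, s o0 = k /\ s o2 = i.
Proof.
move=> ki; pose f p := if p == o0 then k else if p == o2 then i else - (i + k).
have fi : injective f.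
  by move: ki; rewrite /f; clear f; move: i k; apply: I3_ind; apply: I3_ind => // _;
    apply: I3_ind; apply: I3_ind; rewrite /= ?I3E.
by exists (perm fi); rewrite !permE.
Qed.

Lemma eigpair_rep n m d (a b : 'I_d -> K) (M : 'M[K]_d) c : M \in unitmx ->
  (forall i, a i != 0) -> (forall i, b i != 0) ->
  (forall i, a i ^+ n = c) -> (forall i, b i ^+ m = c) ->
  is_rep n m (eigpair a M b).
Proof.
move=> uM a0 b0 an bm.
have udiag (e : 'I_d -> K) : (forall i, e i != 0) ->
    diag_mx (\row_i e i) \in unitmx.
  move=> e0; rewrite unitmxE det_diag unitfE; apply/prodf_neq0 => i _.
  by rewrite mxE.
split=> /=; first exact: udiag.
  by rewrite !unitmx_mul unitmx_inv uM udiag.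
have dcst (e : 'I_d -> K) k : (forall i, e i ^+ k = c) ->
    diag_mx (\row_i e i) ^+ k = c%:M.
  by move=> ek; rewrite diag_mx_exp; apply/matrixP => i j; rewrite !mxE ek.
by rewrite conjmx_exp// (dcst a n an) (dcst b m bm) scalar_mxC mulmxK.
Qed.

End Semisimple.

Section Strata.
Variables (K : numClosedFieldType) (n m : nat) (tau : component_type K n m).

Lemma eps_neq0 i : eps tau i != 0.
Proof.
by apply/eqP => e0; have /eqP := prod_eps tau;
  rewrite (bigD1 i)//= e0 mul0r eq_sym oner_eq0.
Qed.

Lemma veps_neq0 j : veps tau j != 0.
Proof.
by apply/eqP => e0; have /eqP := prod_veps tau;
  rewrite (bigD1 j)//= e0 mul0r eq_sym oner_eq0.
Qed.

Lemma tau_rep d (f g : 'I_d -> 'I_3) (N : 'M[K]_d) : N \in unitmx ->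
  is_rep n m (eigpair (eps tau \o f) N (veps tau \o g)).
Proof.
move=> uN; apply: (@eigpair_rep _ _ _ _ _ _ _ (omega tau)) => // i /=.
- exact: eps_neq0.
- exact: veps_neq0.
- exact: eps_exp.
- exact: veps_exp.
Qed.

Notation a := (eps tau).
Notation b := (veps tau).

(** A corner of zeroes makes the matrix triangular once the eigenvectors are
    suitably ordered. *)
Lemma zero_corner_totally_reducible (M : GL3 K) :
  zero_corner (sval M) -> totally_reducible n m (sval (rho tau M)).
Proof.
case: M => M uM /= [i [j [/two_zerosP[l Mil lE] /two_zerosP[k Mkj kE] Mij]]].
have jl : j != l by apply: contra_eq_neq Mij => ->.
have ki : k != i by apply: contra_eq_neq Mij => <-.
have [s [s0 s2]] := perm_ends ki; have [t [t0 t2]] := perm_ends jl.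
pose M' : 'M[K]_(2 + 1) := row_perm s (col_perm t M).
have uM' : M' \in unitmx.
  rewrite /M' row_permE col_permE !unitmx_mul !unitmx_perm uM.
  by [].
have dl : dlsubmx M' = 0.
  apply/matrixP => p q; rewrite !mxE.
  rewrite (_ : rshift 2 p = o2) ?s2; last by apply: val_inj; rewrite (ord1 p).
  by rewrite lE// -t2 (inj_eq perm_inj); case: q => [[|[|]]].
have [uN uX] := unitmx_ublock uM' dl.
pose N : 'M[K]_(1 + 1) := ulsubmx M'.
have dlN : dlsubmx N = 0.
  apply/matrixP => p q; rewrite !mxE (ord1 p) (ord1 q).
  rewrite (_ : lshift 1 (lshift 1 (0 : 'I_1)) = o0) ?t0; last exact: val_inj.
  by rewrite kE// -s0 (inj_eq perm_inj).
have [uN1 uN2] := unitmx_ublock (uN : N \in unitmx) dlN.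
pose f : 'I_(2 + 1) -> 'I_3 := s; pose g : 'I_(2 + 1) -> 'I_3 := t.
pose V := eigpair (a \o (f \o @lshift 2 1 \o @lshift 1 1)) (ulsubmx N)
  (b \o (g \o @lshift 2 1 \o @lshift 1 1)).
pose V' := eigpair (a \o (f \o @lshift 2 1 \o @rshift 1 1)) (drsubmx N)
  (b \o (g \o @lshift 2 1 \o @rshift 1 1)).
pose V'' := eigpair (a \o (f \o @rshift 2 1)) (drsubmx M')
  (b \o (g \o @rshift 2 1)).
exists V, V', V''; split; [exact: tau_rep|exact: tau_rep|exact: tau_rep|].
exists (dsum (dsum V V') V''); last first.
  have irr1 (W : mxpair K 1) := Semisimpl_irr (irreducible1 W).
  exact: (semisimplification_dsum
    (semisimplification_dsum (irr1 V) (irr1 V')) (irr1 V'')).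
apply: (semisimplification_conj (unitmx_perm _ s)).
rewrite [conj_pair _ _](eigpair_perm a b s t uM).
apply: (@semisimplification_eigpair K 2 1 _ _ M') => //; last first.
  exact/Semisimpl_irr/irreducible1.
apply: (@semisimplification_eigpair K 1 1 _ _ N) => //;
  exact/Semisimpl_irr/irreducible1.
Qed.

(** Once the eigenvectors are suitably ordered the matrix is block triangular; a
    zero in the block of order two would complete a corner, so that block gives
    an irreducible pair. *)
Lemma zero_line_partially_reducible (M : GL3 K) :
  zero_line (sval M) -> ~ zero_corner (sval M) ->
  partially_reducible n m (sval (rho tau M)).
Proof.
case: M => M uM /= zl nc.
have perm_unit (s t : 'S_3) : row_perm s (col_perm t M) \in unitmx.
  by rewrite row_permE col_permE !unitmx_mul !unitmx_perm uM.
have h1 (i : 'I_3) : i + o1 != i by move: i; apply: I3_ind; rewrite !I3E.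
have comp_inj d (f : 'I_3 -> K) (s : 'S_3) (g : 'I_d -> 'I_3) :
    injective f -> injective g -> injective (f \o (s \o g)).
  by move=> fi gi x y /fi /perm_inj /gi.
case: zl => -[i rz]; have /two_zerosP[l Mil lE] := rz.
- have [s [_ s2]] := perm_ends (h1 i); have [t [_ t2]] := perm_ends (h1 l).
  pose M' : 'M[K]_(2 + 1) := row_perm s (col_perm t M).
  have uM' : M' \in unitmx := perm_unit s t.
  have tl (q : 'I_2) : t (lshift 1 q) != l.
    by rewrite -t2 (inj_eq perm_inj); case: q => [[|[|]]].
  have si (q : 'I_2) : s (lshift 1 q) != i.
    by rewrite -s2 (inj_eq perm_inj); case: q => [[|[|]]].
  have dl : dlsubmx M' = 0.
    apply/matrixP => p q; rewrite !mxE.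
    rewrite (_ : rshift 2 p = o2) ?s2; last by apply: val_inj; rewrite (ord1 p).
    by rewrite lE.
  have [uN uX] := unitmx_ublock uM' dl.
  pose f : 'I_(2 + 1) -> 'I_3 := s; pose g : 'I_(2 + 1) -> 'I_3 := t.
  pose V := eigpair (a \o (f \o @lshift 2 1)) (ulsubmx M')
    (b \o (g \o @lshift 2 1)).
  pose W := eigpair (a \o (f \o @rshift 2 1)) (drsubmx M')
    (b \o (g \o @rshift 2 1)).
  have iV : irreducible_pair V.
    apply: irreducible_entries => // [||p q].
    - exact: (comp_inj 2 a s (@lshift 2 1) (@eps_inj _ _ _ tau) (@lshift_inj 2 1)).
    - exact: (comp_inj 2 b t (@lshift 2 1) (@veps_inj _ _ _ tau) (@lshift_inj 2 1)).
    - rewrite !mxE; apply/eqP => M0; apply: nc.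
      exists i, (t (lshift 1 q)); split=> //; last exact: lE.
      exact: unitmx_col_zeros uM (si p) M0 (lE _ (tl q)).
  exists V, W; split=> //; [exact: tau_rep|exact: tau_rep|].
  have irrW := Semisimpl_irr (irreducible1 W).
  exists (dsum V W); last first.
    exact: (semisimplification_dsum (Semisimpl_irr iV) irrW).
  apply: (semisimplification_conj (unitmx_perm _ s)).
  rewrite [conj_pair _ _](eigpair_perm a b s t uM).
  apply: (@semisimplification_eigpair K 2 1 _ _ M') => //.
  exact: (Semisimpl_irr iV).
- have [|s [s0 _]] := @perm_ends (l + o1) l; first by rewrite eq_sym.
  have [|t [t0 _]] := @perm_ends (i + o1) i; first by rewrite eq_sym.
  pose M' : 'M[K]_(1 + 2) := row_perm s (col_perm t M).
  have uM' : M' \in unitmx := perm_unit s t.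
  have ti (q : 'I_2) : t (rshift 1 q) != i by rewrite -t0 (inj_eq perm_inj).
  have sl (q : 'I_2) : s (rshift 1 q) != l by rewrite -s0 (inj_eq perm_inj).
  have dl : dlsubmx M' = 0.
    apply/matrixP => p q; rewrite !mxE.
    rewrite (_ : lshift 2 q = o0) ?t0; last by apply: val_inj; rewrite (ord1 q).
    by rewrite lE.
  have [uX uN] := unitmx_ublock uM' dl.
  pose f : 'I_(1 + 2) -> 'I_3 := s; pose g : 'I_(1 + 2) -> 'I_3 := t.
  pose V := eigpair (a \o (f \o @rshift 1 2)) (drsubmx M')
    (b \o (g \o @rshift 1 2)).
  pose W := eigpair (a \o (f \o @lshift 1 2)) (ulsubmx M')
    (b \o (g \o @lshift 1 2)).
  have iV : irreducible_pair V.
    apply: irreducible_entries => // [||p q].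
    - exact: (comp_inj 2 a s (@rshift 1 2) (@eps_inj _ _ _ tau) (@rshift_inj 1 2)).
    - exact: (comp_inj 2 b t (@rshift 1 2) (@veps_inj _ _ _ tau) (@rshift_inj 1 2)).
    - rewrite !mxE; apply/eqP => M0; apply: nc.
      exists (s (rshift 1 p)), i; split=> //; last exact: lE.
      exact: unitmx_row_zeros uM (ti q) M0 (lE _ (sl p)).
  exists V, W; split=> //; [exact: tau_rep|exact: tau_rep|].
  have irrW := Semisimpl_irr (irreducible1 W).
  exists (dsum W V : mxpair K 3); last first.
    apply: (@Semisimpl_conj _ 3 (dsum V W) (dsum V W) (dsum V W) (dsum W V)).
    - exact: (semisimplification_dsum (Semisimpl_irr iV) irrW).
    - exact: similar_refl.
    - exact: dsum_swap.
  apply: (semisimplification_conj (unitmx_perm _ s)).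
  rewrite [conj_pair _ _](eigpair_perm a b s t uM).
  apply: (@semisimplification_eigpair K 1 2 _ _ M') => //.
  exact: (Semisimpl_irr iV).
Qed.

End Strata.

(** * Zero patterns in determinant coordinates *)

Section Support.
Variable K : closedFieldType.
Implicit Types M : 'M[K]_3.

Definition incident (e : K33_edge) (w : K33_vertex) : bool :=
  (w == inl e.1) || (w == inr e.2).

Lemma incidentP e w : reflect (K33_incident e w) (incident e w).
Proof.
apply: (iffP orP) => [[/eqP|/eqP]|[->|->]]; [by left|by right|left|right];
  exact: eqxx.
Qed.

(** The edge joining the two permutations that send [i] to [j]. *)
Definition cell_edge (i j : 'I_3) : K33_edge := (j - i, i + j).

Lemma incident_cell i j w : incident (cell_edge i j) w = (vperm w i == j).
Proof.
by move: i j w; apply: I3_ind; apply: I3_ind; apply: K33_vertex_ind;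
  rewrite /incident /= !I3E.
Qed.

Lemma vperm_inj w : injective (vperm w).
Proof.
by move: w; apply: K33_vertex_ind; apply: I3_ind; apply: I3_ind;
  rewrite /vperm !I3E.
Qed.

Lemma vperm_onto w j : exists i, vperm w i = j.
Proof.
case: w => a; first by exists (j - a); rewrite /= subrK.
by exists (a - j); rewrite /= opprB addrC subrK.
Qed.

Lemma lcoord_neq0 w M : M \in unitmx -> (lcoord w M != 0) = (leibniz w M != 0).
Proof.
rewrite unitmxE unitfE => dM; rewrite /lcoord !mulf_eq0 invr_eq0 (negPf dM) orbF.
by case: w => ? /=; rewrite ?oppr_eq0 oner_eq0.
Qed.

Lemma leibniz_neq0P w M : reflect (forall i, M i (vperm w i) != 0) (leibniz w M != 0).
Proof.
by apply: (iffP (prodf_neq0 _ _)) => [H i|H i _]; apply: H.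
Qed.

Definition supported (M : 'M[K]_3) e := forall w, ~~ incident e w -> lcoord w M = 0.

Lemma supported_row M i l : M \in unitmx -> (forall j, j != l -> M i j = 0) ->
  supported M (cell_edge i l).
Proof.
move=> uM lE w; rewrite incident_cell => wl; apply/eqP; apply: contraT.
by rewrite lcoord_neq0// => /leibniz_neq0P/(_ i); rewrite lE ?eqxx.
Qed.

Lemma supported_col M j k : M \in unitmx -> (forall i, i != k -> M i j = 0) ->
  supported M (cell_edge k j).
Proof.
move=> uM kE w; rewrite incident_cell => wk; apply/eqP; apply: contraT.
rewrite lcoord_neq0// => /leibniz_neq0P; have [i wi] := vperm_onto w j.
move/(_ i); rewrite wi kE ?eqxx//; apply: contra_neq wk => <-.
exact: wi.
Qed.

Lemma zero_line_supported M : M \in unitmx -> zero_line M ->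
  exists e, supported M e.
Proof.
move=> uM [[i /two_zerosP[l _ lE]]|[j /two_zerosP[k _ kE]]].
  by exists (cell_edge i l); apply: supported_row.
by exists (cell_edge k j); apply: supported_col.
Qed.

(** Four Leibniz terms vanish while the determinant does not.  Once the entry
    common to the two surviving ones is shifted to the corner, it is enough to
    go through the zero patterns. *)
Lemma supported_zero_line M e : M \in unitmx -> supported M e -> zero_line M.
Proof.
move=> uM sM; pose B := shift_mx (- e.1, - e.2) M.
have BE i j : B i j = M (i + e.1 - e.2) (j - (e.1 + e.2)).
  by rewrite mxE /= !opprD !opprK addrA.
have pB w : w != inl o0 -> w != inr o0 -> leibniz w B = 0.
  move=> w1 w2; rewrite leibniz_shift; apply/eqP; apply: contraT.
  rewrite -lcoord_neq0// sM ?eqxx//; rewrite /incident.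
  have o00 : o0 = 0 by apply: val_inj.
  case: w w1 w2 => c /= w1 w2; rewrite opprK.
    rewrite orbF; apply: contra w1 => /eqP[] /(canRL (addrK _)) ->.
    by rewrite subrr o00.
  apply: contra w2 => /eqP[] /(canRL (addrK _)) ->.
  by rewrite subrr o00.
have dB : (leibniz (inl o0) B != 0) || (leibniz (inr o0) B != 0).
  apply: contraT; rewrite negb_or !negbK => /andP[/eqP p1 /eqP p2].
  have : \det M != 0 by rewrite -unitfE -unitmxE.
  suff -> : \det M = 0 by rewrite eqxx.
  have pM w : leibniz w M = 0.
    have -> : w = shift_vertex (- e.1, - e.2) (shift_vertex e w).
      by rewrite shift_vertexK.
    rewrite -leibniz_shift; move: (shift_vertex e w) => {}w.
    case: (eqVneq w (inl o0)) => [->//|w1].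
    by case: (eqVneq w (inr o0)) => [->//|w2]; apply: pB.
  by rewrite det_leibniz !big1 ?subrr.
have row_z i j k : j != k -> B i j = 0 -> B i k = 0 -> zero_line M.
  rewrite !BE => jk Bj Bk; left; exists (i + e.1 - e.2).
  by apply: unitmx_row_zeros Bj Bk => //; rewrite (inj_eq (addIr _)).
have col_z i j k : j != k -> B j i = 0 -> B k i = 0 -> zero_line M.
  rewrite !BE => jk Bj Bk; right; exists (i - (e.1 + e.2)).
  by apply: unitmx_col_zeros Bj Bk => //; rewrite !(inj_eq (addIr _)).
have q1 := pB (inl o1) isT isT; have q2 := pB (inl o2) isT isT.
have q3 := pB (inr o1) isT isT; have q4 := pB (inr o2) isT isT.
move: dB q1 q2 q3 q4; rewrite !leibnizE /vperm !I3E.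
move=> dB /eqP q1 /eqP q2 /eqP q3 /eqP q4; move: dB q1 q2 q3 q4.
rewrite !mulf_eq0.
have rz i j k (jk : j != k) : (B i j == 0) && (B i k == 0) -> zero_line M.
  by case/andP=> /eqP + /eqP; apply: row_z.
have cz i j k (jk : j != k) : (B j i == 0) && (B k i == 0) -> zero_line M.
  by case/andP=> /eqP + /eqP; apply: col_z.
have := (rz o0 o1 o2 isT, rz o1 o1 o2 isT, rz o2 o1 o2 isT, rz o0 o0 o1 isT,
  rz o0 o0 o2 isT, rz o1 o0 o1 isT, rz o1 o0 o2 isT, rz o2 o0 o1 isT,
  rz o2 o0 o2 isT, (cz o0 o1 o2 isT, cz o1 o1 o2 isT, cz o2 o1 o2 isT,
  cz o0 o0 o1 isT, cz o0 o0 o2 isT, cz o1 o0 o1 isT, cz o1 o0 o2 isT,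
  cz o2 o0 o1 isT, cz o2 o0 o2 isT)).
clear; case: (B o0 o0 == 0); case: (B o0 o1 == 0); case: (B o0 o2 == 0);
case: (B o1 o0 == 0); case: (B o1 o1 == 0); case: (B o1 o2 == 0);
case: (B o2 o0 == 0); case: (B o2 o1 == 0); case: (B o2 o2 == 0) => //=; tauto.
Qed.

(** A further zero would be the second one in its column and complete a
    corner. *)
Lemma row_off_cell M i l : M \in unitmx -> two_zeros_row M i ->
  (forall j, j != l -> M i j = 0) -> ~ zero_corner M ->
  forall p q, p != i -> q != l -> M p q != 0.
Proof.
move=> uM rz lE nc p q pi ql; apply/eqP => M0; apply: nc.
exists i, q; split=> //; last exact: lE.
exact: unitmx_col_zeros uM pi M0 (lE _ ql).
Qed.

Lemma col_off_cell M j k : M \in unitmx -> two_zeros_col M j ->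
  (forall i, i != k -> M i j = 0) -> ~ zero_corner M ->
  forall p q, p != k -> q != j -> M p q != 0.
Proof.
move=> uM cz kE nc p q pk qj; apply/eqP => M0; apply: nc.
exists p, j; split=> //; last exact: kE.
exact: unitmx_row_zeros uM qj M0 (kE _ pk).
Qed.

Lemma zero_line_edge M : M \in unitmx -> zero_line M -> ~ zero_corner M ->
  exists2 e, supported M e & forall w, incident e w -> lcoord w M != 0.
Proof.
move=> uM [[i rz]|[j cz]] nc.
  have /two_zerosP[l Ml lE] := rz; exists (cell_edge i l).
    exact: supported_row.
  move=> w; rewrite incident_cell => /eqP wi; rewrite lcoord_neq0//.
  apply/leibniz_neq0P => p; case: (eqVneq p i) => [->|pi]; first by rewrite wi.
  apply: (row_off_cell uM rz lE nc) => //.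
  by rewrite -wi (inj_eq (@vperm_inj w)).
have /two_zerosP[k Mk kE] := cz; exists (cell_edge k j).
  exact: supported_col.
move=> w; rewrite incident_cell => /eqP wk; rewrite lcoord_neq0//.
apply/leibniz_neq0P => p; case: (eqVneq p k) => [->|pk]; first by rewrite wk.
apply: (col_off_cell uM cz kE nc) => //.
by rewrite -wk (inj_eq (@vperm_inj w)).
Qed.

(** The row and the column of a corner prescribe two values of a permutation,
    hence a single Leibniz term. *)
Lemma zero_corner_vertex M : M \in unitmx -> zero_corner M ->
  exists w, forall w', w' != w -> lcoord w' M = 0.
Proof.
move=> uM [i [j [/two_zerosP[l Ml lE] /two_zerosP[k Mk kE] Mij]]].
have ki : k != i by apply: contra_eq_neq Mij => <-.
have sP w : lcoord w M != 0 -> vperm w i = l /\ vperm w k = j.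
  move=> w0; split; apply/eqP; rewrite -incident_cell; apply: contraT => nw.
    by rewrite (supported_row uM lE nw) eqxx in w0.
  by rewrite (supported_col uM kE nw) eqxx in w0.
have [w w0] : exists w, lcoord w M != 0.
  apply/existsP; apply: contraT; rewrite negb_exists => /forallP u0.
  have := sum_lcoord uM; rewrite big1 => [/eqP|w _].
    by rewrite eq_sym oner_eq0.
  by apply/eqP; have := u0 w; rewrite negbK.
exists w => w' ww'; apply/eqP; apply: contraT => w0'.
have [wi wk] := sP _ w0; have [wi' wk'] := sP _ w0'.
move: ww' ki; rewrite -wi in wi'; rewrite -wk in wk'; clear -wi' wk'.
by move: wi' wk'; move: w w' i k; do 2!apply: K33_vertex_ind; apply: I3_ind;
  apply: I3_ind; rewrite /vperm !I3E.
Qed.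

Lemma zero_countE M : zero_count M = (\sum_i \sum_j (M i j == 0%R))%N.
Proof.
rewrite /zero_count -sum1_card pair_big big_mkcond /=.
by apply: eq_bigr => -[i j] _; rewrite -topredE /=; case: (M i j == 0).
Qed.

Lemma zero_corner_count M : zero_corner M -> (3 <= zero_count M)%N.
Proof.
move=> [i [j []]]; rewrite /two_zeros_row /two_zeros_col !card_I3 /=.
rewrite zero_countE !big_I3 /= => + + /eqP.
move: i j; apply: I3_ind; apply: I3_ind;
case: (M o0 o0 == 0); case: (M o0 o1 == 0); case: (M o0 o2 == 0);
case: (M o1 o0 == 0); case: (M o1 o1 == 0); case: (M o1 o2 == 0);
case: (M o2 o0 == 0); case: (M o2 o1 == 0); case: (M o2 o2 == 0) => //.
Qed.

End Support.

(** * The nine lines *)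

Section EdgeMatrices.
Variable K : closedFieldType.

(** The matrix has determinant one for all [t], its two surviving signed
    Leibniz terms being [t] and [1 - t]. *)
Definition edge_mx (e : K33_edge) (t : K) : 'M[K]_3 :=
  shift_mx e (mx3 1 0 0 1 t 1 1 (t - 1) 1).

Definition edge_coord (e : K33_edge) (t : K) (w : K33_vertex) : K :=
  if w == inl e.1 then t else if w == inr e.2 then 1 - t else 0.

Lemma leibniz_edge e t w : vsign K w * leibniz w (edge_mx e t) = edge_coord e t w.
Proof.
rewrite leibniz_shift -[in RHS](shift_vertexK e w).
have -> : vsign K w = vsign K (shift_vertex e w) by case: w.
have -> : edge_coord e t (shift_vertex (- e.1, - e.2) (shift_vertex e w)) =
    edge_coord (o0, o0) t (shift_vertex e w).
  have o00 : o0 = 0 by apply: val_inj.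
  by case: w => c; rewrite /edge_coord /= !opprK subrK
    -![(_ == _ :> K33_vertex)]/(_ == _ :> 'I_3) subr_eq o00 add0r.
move: (shift_vertex e w) => {}w; rewrite leibnizE.
by move: w; apply: K33_vertex_ind; rewrite /vperm !I3E !mx3E /edge_coord /=; ring.
Qed.

Lemma sum_edge_coord e t : \sum_w edge_coord e t w = 1.
Proof.
rewrite big_sumType /= (bigD1 e.1)//= (bigD1 e.2 (P := xpredT))//=.
rewrite /edge_coord /= !eqxx !big1 ?addr0 => [|b|a] ; first by ring.
- by rewrite -[inr _ == _]/(b == e.2) => /negPf->.
- by rewrite -[inl _ == _]/(a == e.1) => /negPf->.
Qed.

Lemma det_edge e t : \det (edge_mx e t) = 1.
Proof.
rewrite det_leibniz -(sum_edge_coord e t) big_sumType /= -sumrN.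
by congr (_ + _); apply: eq_bigr => i _; rewrite -leibniz_edge /= ?mul1r ?mulN1r.
Qed.

Lemma edge_unit e t : edge_mx e t \in unitmx.
Proof. by rewrite unitmxE det_edge unitr1. Qed.

Lemma lcoord_edge e t w : lcoord w (edge_mx e t) = edge_coord e t w.
Proof. by rewrite /lcoord leibniz_edge det_edge divr1. Qed.

Lemma edge_mxE e t i j : edge_mx e t (i + (e.1 - e.2)) (j - (e.1 + e.2)) =
  mx3 1 0 0 1 t 1 1 (t - 1) 1 i j.
Proof. by rewrite mxE addrK subrK. Qed.

Lemma edge_zero_line e t : zero_line (edge_mx e t).
Proof.
left; exists (o0 + (e.1 - e.2)); apply/two_zerosP.
exists (o0 - (e.1 + e.2)); first by rewrite edge_mxE mx3E oner_neq0.
move=> j; rewrite -[j](addrK (e.1 + e.2)) edge_mxE (inj_eq (addIr _)).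
by move: (j + _); apply: I3_ind => //; rewrite mx3E.
Qed.

Lemma edge_zero_count e t : t != 0 -> t != 1 -> zero_count (edge_mx e t) = 2%N.
Proof.
move=> /negPf t0 t1; have /negPf t10 : t - 1 != 0 by rewrite subr_eq0.
rewrite zero_countE (reindex_inj (addIr (e.1 - e.2))) /=.
under eq_bigr => i _.
  rewrite (reindex_inj (addIr (- (e.1 + e.2)))) /=.
  under eq_bigr do rewrite edge_mxE.
  over.
by rewrite !big_I3 /= !mx3E eqxx oner_eq0 t0 t10.
Qed.

Lemma edge_corner e t : t = 0 \/ t = 1 ->
  zero_corner (edge_mx e t) /\ zero_count (edge_mx e t) = 3%N.
Proof.
have n10 := negPf (oner_neq0 K); have nN10 : (-1 : K) == 0 = false.
  by rewrite oppr_eq0.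
move=> t01; split; last first.
  rewrite zero_countE (reindex_inj (addIr (e.1 - e.2))) /=.
  under eq_bigr => i _.
    rewrite (reindex_inj (addIr (- (e.1 + e.2)))) /=.
    under eq_bigr do rewrite edge_mxE.
    over.
  by case: t01 => ->; rewrite !big_I3 /= !mx3E ?subrr ?sub0r eqxx n10 ?nN10.
exists (o0 + (e.1 - e.2)).
exists (o1 - (e.1 + e.2)); case: t01 => ->; split; try by rewrite edge_mxE mx3E.
- apply/two_zerosP; exists (o0 - (e.1 + e.2)); rewrite ?edge_mxE ?mx3E ?n10//.
  move=> j; rewrite -[j](addrK (e.1 + e.2)) edge_mxE (inj_eq (addIr _)).
  by move: (j + _); apply: I3_ind => //; rewrite mx3E.
- apply/two_zerosP; exists (o2 + (e.1 - e.2)).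
    by rewrite edge_mxE mx3E sub0r nN10.
  move=> j; rewrite -[j](subrK (e.1 - e.2)) edge_mxE (inj_eq (addIr _)).
  by move: (j - _); apply: I3_ind => //; rewrite mx3E.
- apply/two_zerosP; exists (o0 - (e.1 + e.2)); rewrite ?edge_mxE ?mx3E ?n10//.
  move=> j; rewrite -[j](addrK (e.1 + e.2)) edge_mxE (inj_eq (addIr _)).
  by move: (j + _); apply: I3_ind => //; rewrite mx3E.
- apply/two_zerosP; exists (o1 + (e.1 - e.2)).
    by rewrite edge_mxE mx3E n10.
  move=> j; rewrite -[j](subrK (e.1 - e.2)) edge_mxE (inj_eq (addIr _)).
  by move: (j - _); apply: I3_ind => //; rewrite mx3E ?subrr.
Qed.

End EdgeMatrices.

Section Lines.
Variables (K : numClosedFieldType) (n m : nat) (tau : component_type K n m).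
Notation charvar := (Defs.charvar K n m).
Notation comp := (component tau).
Notation rho := (rho tau).
Notation U := (lcoord_pt tau).

Definition edge_GL e (t : K) : GL3 K :=
  exist (fun M : 'M[K]_3 => M \in unitmx) _ (edge_unit e t).

Definition line_pt e t : charvar := charpt (rho (edge_GL e t)).

Lemma lcoord_pt_line e t w : U w (line_pt e t) = edge_coord e t w.
Proof. by rewrite lcoord_pt_rho lcoord_edge. Qed.

Lemma closure_line_pt e t : zclosure comp (line_pt e t).
Proof. exact: closure_rho. Qed.

(** The two remaining coordinates add up to one, so [U (inl e.1)] is a parameter
    on the line; in this form the line is visibly closed. *)
Definition line e : set charvar :=
  [set p | zclosure comp p /\ forall w, ~~ incident e w -> U w p = 0].

Lemma edge_coord_off e t w : ~~ incident e w -> edge_coord e t w = 0 :> K.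
Proof. by rewrite negb_or /edge_coord => /andP[/negPf-> /negPf->]. Qed.

Lemma line_line_pt e t : line e (line_pt e t).
Proof.
split=> [|w nw]; first exact: closure_line_pt.
by rewrite lcoord_pt_line edge_coord_off.
Qed.

Lemma sum_lcoord_pt p : zclosure comp p -> \sum_w U w p = 1.
Proof.
move=> /closure_orbit[M ->]; rewrite -(sum_lcoord (svalP M)).
by apply: eq_bigr => w _; rewrite lcoord_pt_rho.
Qed.

Lemma line_ptE e p : line e p -> p = line_pt e (U (inl e.1) p).
Proof.
move=> [cp Up]; apply: (closure_coord cp (closure_line_pt _ _)) => w.
rewrite lcoord_pt_line; case: (boolP (incident e w)) => [|nw]; last first.
  by rewrite Up// edge_coord_off.
case/orP=> /eqP ->; rewrite /edge_coord ?eqxx//=.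
rewrite -(sum_lcoord_pt cp) big_sumType /= (bigD1 e.1)//= big1 => [|a ae].
  rewrite (bigD1 e.2)//= big1 => [|b be]; first by rewrite !addr0 addrC addrK.
  by apply: Up; rewrite /incident /= -[inr _ == _]/(b == e.2).
by apply: Up; rewrite /incident orbF -[inl _ == _]/(a == e.1).
Qed.

Lemma edge_coord_inl e t : edge_coord e t (inl e.1) = t :> K.
Proof. by rewrite /edge_coord eqxx. Qed.

Lemma zclosed_line e : zclosed (line e).
Proof.
pose S := [set f | exists2 F, f = git_val F & forall q, comp q -> git_val F q = 0]
  `|` [set f | exists2 w, ~~ incident e w & f = U w].
exists S => [f [[F -> _]|[w _ ->]]|]; [exact: git_reg|exact: git_reg|].
apply/seteqP; split=> [p [cp Up] f [[F -> F0]|[w nw ->]]|p Sp].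
- exact: (zclosureP _ _).1 cp F F0.
- exact: Up.
- split=> [|w nw]; last by apply: Sp; right; exists w.
  by apply: (zclosureP _ _).2 => F F0; apply: Sp; left; exists F.
Qed.

Definition line_param e (t : affine_line K) : subvariety (line e) :=
  exist _ _ (line_line_pt e t).

Lemma line_isomorphism e : isomorphism (@line_param e).
Proof.
split.
  move=> f [g [F gF] fg]; apply/reg_affine_line.
  have [h ph hF] := closure_polyfun tau F.
  apply: (@gen_ext _ _ _ _ (fun t => h (edge_coord e t))) => [t|].
    rewrite /= fg gF -[RHS]/(git_val F (line_pt e t)) hF; last first.
      exact: closure_line_pt.
    by congr h; apply/funext => w; rewrite lcoord_pt_line.
  apply: gen_trans (gen_comp (edge_coord e) ph) => w.
  have gt := gen_var (fun (_ : unit) (t : K) => t) tt.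
  apply: (@gen_ext _ _ _ _ (fun t => edge_coord e t w)) => //.
  rewrite /edge_coord; case: (w == _) => //; case: (w == _); last exact: gen_cst.
  by apply: gen_sub => //; exact: gen_cst.
exists (fun z : subvariety (line e) => U (inl e.1) (sval z)); split.
- move=> f /reg_affine_line gf.
  have := gen_comp (fun z : subvariety (line e) => U (inl e.1) (sval z)) gf.
  apply: gen_subalgebra => [|_]; last first.
    by exists (U (inl e.1)) => //; exact: git_reg.
  have [S0 SD SM] := subalgebra_git (@SL3_act K n m)
    (subalgebra_repvar K n m).
  split=> [a|f1 f2 [g1 r1 e1] [g2 r2 e2]|f1 f2 [g1 r1 e1] [g2 r2 e2]].
  + by exists (fun=> a).
  + by exists (fun x => g1 x + g2 x) => [|z]; [exact: SD|rewrite e1 e2].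
  + by exists (fun x => g1 x * g2 x) => [|z]; [exact: SM|rewrite e1 e2].
- move=> t; rewrite -[LHS]/(U (inl e.1) (line_pt e t)).
  by rewrite lcoord_pt_line edge_coord_inl.
- by move=> z; apply: sval_inj; apply/esym/line_ptE; exact: (svalP z).
Qed.

Lemma irreducible_rho (M : GL3 K) :
  irreducible_pair (sval (rho M)) <-> ~ zero_line (sval M).
Proof.
split=> [irr zl|nz].
  exact: (zero_line_reducible (svalP M) zl irr).
by apply: irreducible_no_zero_line nz;
  [exact: eps_inj|exact: veps_inj|exact: (svalP M)].
Qed.

Lemma line_rho (M : GL3 K) e : line e (charpt (rho M)) <-> supported (sval M) e.
Proof.
split=> [[_ H] w nw|H]; first by rewrite -(lcoord_pt_rho tau) H.
by split=> [|w nw]; [exact: closure_rho|rewrite lcoord_pt_rho H].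
Qed.

Lemma boundary_rho (M : GL3 K) :
  boundary tau (charpt (rho M)) <-> zero_line (sval M).
Proof.
split=> [[_ nc]|zl].
  apply: contrapT => /irreducible_rho irr; apply: nc.
  by apply/component_rho; exists M.
split; first exact: closure_rho.
case/component_rho=> M' /irreducible_rho nz E; apply: nz.
have [e sM] := zero_line_supported (svalP M) zl.
have := (line_rho M e).2 sM; rewrite E => /line_rho.
exact: supported_zero_line (svalP M').
Qed.

Lemma boundary_lines : boundary tau = \bigcup_(e in [set: K33_edge]) line e.
Proof.
apply/seteqP; split=> [p bp|p [e _ Lp]].
  have [M pM] := closure_orbit bp.1; rewrite pM in bp *.
  have /boundary_rho zl := bp; have [e sM] := zero_line_supported (svalP M) zl.
  by exists e => //; apply/line_rho.
by rewrite (line_ptE Lp); apply/boundary_rho; apply: edge_zero_line.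
Qed.

Lemma generic_stratum (M : GL3 K) : zero_line (sval M) -> ~ zero_corner (sval M) ->
  exists e t, [/\ t != 0, t != 1 & charpt (rho M) = line_pt e t].
Proof.
move=> zl nc; have [e sM nz] := zero_line_edge (svalP M) zl nc.
have := line_ptE ((line_rho M e).2 sM); set t := U _ _ => Mt.
exists e, t; split=> //.
  by rewrite /t lcoord_pt_rho nz// /incident eqxx.
have : U (inr e.2) (charpt (rho M)) != 0.
  by rewrite lcoord_pt_rho nz// /incident eqxx orbT.
by rewrite Mt lcoord_pt_line /edge_coord /= eqxx subr_eq0 eq_sym.
Qed.

Lemma corner_stratum (M : GL3 K) : zero_corner (sval M) ->
  exists e t, (t = 0 \/ t = 1) /\ charpt (rho M) = line_pt e t.
Proof.
move=> zc; have [w0 wu] := zero_corner_vertex (svalP M) zc.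
have uw0 : lcoord w0 (sval M) = 1.
  by rewrite -(sum_lcoord (svalP M)) (bigD1 w0)//= big1 ?addr0.
have sM e : incident e w0 -> line e (charpt (rho M)).
  move=> ew; apply/line_rho => w nw; apply: wu.
  by apply: contraNneq nw => ->.
case: w0 wu uw0 sM => c wu uc sM.
  exists (c, o0), 1; split; first by right.
  have L : line (c, o0) (charpt (rho M)) by apply: sM; rewrite /incident eqxx.
  by rewrite {1}(line_ptE L) lcoord_pt_rho uc.
exists (o0, c), 0; split; first by left.
have L : line (o0, c) (charpt (rho M)) by apply: sM; rewrite /incident eqxx orbT.
by rewrite {1}(line_ptE L) lcoord_pt_rho wu.
Qed.

Definition vertex (w : K33_vertex) : charvar :=
  match w with inl a => line_pt (a, o0) 1 | inr b => line_pt (o0, b) 0 end.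

Lemma lcoord_pt_vertex w w' : U w' (vertex w) = (w' == w)%:R.
Proof.
case: w => c; rewrite lcoord_pt_line /edge_coord /=.
  by case: eqP => // _; case: eqP => // _; rewrite subrr.
case: eqP => [->//|_].
by case: eqP => // _; rewrite subr0.
Qed.

Lemma closure_vertex w : zclosure comp (vertex w).
Proof. by case: w => c; apply: closure_line_pt. Qed.

Lemma vertex_eq p w : zclosure comp p -> (forall w', w' != w -> U w' p = 0) ->
  p = vertex w.
Proof.
move=> cp pw; apply: (closure_coord cp (closure_vertex w)) => w'.
rewrite lcoord_pt_vertex; case: (eqVneq w' w) => [->|/pw//].
by rewrite -(sum_lcoord_pt cp) (bigD1 w)//= big1 ?addr0.
Qed.

Lemma line_vertex e w : line e (vertex w) <-> K33_incident e w.
Proof.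
split=> [[_ H]|/incidentP ew].
  apply/incidentP; apply: contraT => /H; rewrite lcoord_pt_vertex eqxx => /eqP.
  by rewrite oner_eq0.
split=> [|w' nw']; first exact: closure_vertex.
by rewrite lcoord_pt_vertex; case: eqP => // E; rewrite E ew in nw'.
Qed.

Lemma vertex_inj : injective vertex.
Proof.
move=> w w' /(congr1 (U w)); rewrite !lcoord_pt_vertex eqxx; case: eqP => // _ /eqP.
by rewrite oner_eq0.
Qed.

Lemma line_inj : injective line.
Proof.
move=> e e' ee'; have : line e' (line_pt e 2%:R).
  by rewrite -ee'; apply: line_line_pt.
(* any parameter other than 0 and 1 separates the lines *)
have n2 : (1 - 2%:R : K) != 0.
  by rewrite (_ : 1 - 2%:R = -1) ?oppr_eq0 ?oner_eq0//; ring.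
case=> _ H; have h1 : incident e' (inl e.1).
  apply: contraT => /H; rewrite lcoord_pt_line edge_coord_inl => /eqP.
  by rewrite pnatr_eq0.
have h2 : incident e' (inr e.2).
  apply: contraT => /H; rewrite lcoord_pt_line /edge_coord eqxx => /eqP.
  by rewrite (negPf n2).
case: e e' h1 h2 {ee' H} => a b [a' b'].
by rewrite /incident /= orbF => /eqP[->] /eqP[->].
Qed.

Lemma line_cap e e' p : e <> e' -> line e p -> line e' p ->
  exists2 w, K33_incident e w /\ K33_incident e' w & vertex w = p.
Proof.
move=> ee' [cp He] [_ He'].
have sup w : U w p != 0 -> incident e w && incident e' w.
  by move=> w0; apply/andP; split; apply: contraT => ni; move: w0;
    rewrite ?(He _ ni) ?(He' _ ni) eqxx.
have [w w0] : exists w, U w p != 0.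
  apply/existsP; apply: contraT; rewrite negb_exists => /forallP U0.
  have := sum_lcoord_pt cp; rewrite big1 => [/eqP|w _].
    by rewrite eq_sym oner_eq0.
  by apply/eqP; have := U0 w; rewrite negbK.
have /andP[ew ew'] := sup _ w0.
exists w; first by split; apply/incidentP.
apply/esym/vertex_eq => // w' ww'; apply/eqP; apply: contraT => w0'.
have /andP[fw fw'] := sup _ w0'; case: ee'.
case: e e' ew ew' fw fw' ww' {He He' sup} => a b [a' b'].
rewrite /incident /= => /orP[]/eqP-> /orP[]/eqP // => -[<-] /orP[]/eqP->;
  rewrite ?eqxx // => /orP[]/eqP // [->] //.
Qed.

Lemma line_generic e p : line e p -> ~ range vertex p ->
  exists t, [/\ t != 0, t != 1 & p = line_pt e t].
Proof.
move=> Lp nv; exists (U (inl e.1) p); split; last exact: line_ptE.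
  apply/eqP => t0; apply: nv; exists (inr e.2) => //.
  apply/esym/vertex_eq => [|w wn]; first exact: Lp.1.
  case: (eqVneq w (inl e.1)) => [->//|wl]; apply: Lp.2.
  by rewrite /incident negb_or wl wn.
apply/eqP => t1; apply: nv; exists (inl e.1) => //.
apply/esym/vertex_eq => [|w wn]; first exact: Lp.1.
by rewrite (line_ptE Lp) t1 lcoord_pt_line /edge_coord (negPf wn) subrr if_same.
Qed.

End Lines.

(** * Totally reducible points *)

Section TotallyReducible.
Variables (K : numClosedFieldType) (n m : nat) (tau : component_type K n m).
Notation rho := (rho tau).
Notation a := (eps tau).
Notation b := (veps tau).

(** Newton's identities: after elimination of the third variable the cube of the
    first is a combination of the second and third power sums. *)
Lemma power_sums3 (x y z : K) : x + y + z = 0 ->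
  x ^+ 2 + y ^+ 2 + z ^+ 2 = 0 -> x ^+ 3 + y ^+ 3 + z ^+ 3 = 0 ->
  [/\ x = 0, y = 0 & z = 0].
Proof.
have core (p q r : K) : p + q + r = 0 -> p ^+ 2 + q ^+ 2 + r ^+ 2 = 0 ->
    p ^+ 3 + q ^+ 3 + r ^+ 3 = 0 -> p = 0.
  move=> /(canRL (addKr _)); rewrite addr0 opprD => -> p2 p3.
  have : 6%:R * p ^+ 3 = 3%:R * p * (p ^+ 2 + q ^+ 2 + (- p - q) ^+ 2) +
    2%:R * (p ^+ 3 + q ^+ 3 + (- p - q) ^+ 3) by ring.
  rewrite p2 p3 !mulr0 addr0 => /eqP.
  by rewrite mulf_eq0 pnatr_eq0 expf_eq0 /= => /eqP.
move=> s1 s2 s3; split; first exact: core s1 s2 s3.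
  by apply: (core y z x); rewrite addrC addrA.
by apply: (core z x y); rewrite -addrA addrC.
Qed.

(** On a sum of characters, the words [word_P a i] and [word_Q b j] take
    idempotent values, because the characters send the two generators to
    prescribed eigenvalues.  The latter holds since the values of [rootpoly a]
    and [rootpoly b] have vanishing power sums, which are traces of zero matrices
    on the side of [rho tau M].  There, on the other hand, the projectors have
    rank one. *)
Lemma totally_reducible_trace (M : GL3 K) (r : repvar K n m) i j :
  totally_reducible n m (sval r) -> charpt r = charpt (rho M) ->
  let x := sval M i j * invmx (sval M) j i in x ^+ 2 = x.
Proof.
move=> [V [V' [V'' [_ _ _ rV]]]] rM x; have uM := svalP M.
have tr w : \tr (word_eval (sval (rho M)) w) = char1 V w + char1 V' w + char1 V'' w.
  rewrite -[LHS](trace_inv_charpt w (rho M)) -rM trace_inv_charpt.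
  rewrite (tr_word_S_equivalent w rV).
  rewrite -!char1_tr -tr_word_dsum.
  exact: (tr_word_dsum (dsum V V') V'' w).
have nil w : word_eval (sval (rho M)) w = 0 ->
    [/\ char1 V w = 0, char1 V' w = 0 & char1 V'' w = 0].
  move=> w0; have s k : char1 V w ^+ k.+1 + char1 V' w ^+ k.+1 +
      char1 V'' w ^+ k.+1 = 0.
    by rewrite -!char1_pow -tr /= w0 mul0mx mxtrace0.
  have := (s 0, s 1, s 2)%N; rewrite !expr1 => -[[s1 s2] s3].
  exact: power_sums3 s1 s2 s3.
have idem (W : mxpair K 1) :
    char1 W (word_poly (WA K) (rootpoly a)) = 0 ->
    char1 W (word_poly (WB K) (rootpoly b)) = 0 ->
    char1 W (WMul (word_PQ a b i j) (word_PQ a b i j)) = char1 W (word_PQ a b i j).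
  rewrite !char1_poly => /eqP/rootpolyP[k ak] /eqP/rootpolyP[l bl].
  rewrite !char1_mul !char1_poly ak bl !horner_lagrange;
    [|exact: veps_inj|exact: eps_inj].
  by case: (k == i); case: (l == j); rewrite ?(mulr0, mulr1, mul0r).
have [A1 A2 A3] := nil _ (word_rootA a b (sval M)).
have [B1 B2 B3] := nil _ (word_rootB a b uM).
have tPQ : \tr (word_eval (sval (rho M)) (word_PQ a b i j)) = x.
  exact: (tr_PQ (@eps_inj _ _ _ tau) (@veps_inj _ _ _ tau) uM).
have <- : \tr (word_eval (sval (rho M))
    (WMul (word_PQ a b i j) (word_PQ a b i j))) = x ^+ 2.
  exact: (tr_PQPQ (@eps_inj _ _ _ tau) (@veps_inj _ _ _ tau) uM).
by rewrite -tPQ !tr !idem.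
Qed.

Lemma range_vertex : range (vertex tau) =
  boundary tau `&` totally_reducible_pts (n:=n) (m:=m).
Proof.
apply/seteqP; split=> [_ [w _ <-]|p [bp [r tr rp]]].
  have [e [t [t01 ->]]] : exists e t, (t = 0 \/ t = 1) /\
      vertex tau w = line_pt tau e t.
    by case: w => c; [exists (c, o0), 1|exists (o0, c), 0]; split=> //;
      [right|left].
  split; first by apply/boundary_rho; apply: edge_zero_line.
  exists (rho (edge_GL e t)) => //; apply: zero_corner_totally_reducible.
  exact: (edge_corner e t01).1.
have [e _ Lp] : (\bigcup_(e in [set: K33_edge]) line tau e) p.
  by rewrite -boundary_lines.
apply: contrapT => nv; have [t [t0 t1 pE]] := line_generic Lp nv.
(* a cell of [inl e.1] that is not a cell of [inr e.2] *)
have [i ie] : exists i : 'I_3, i + (i + e.1) != e.2.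
  have [|] := boolP (o0 + (o0 + e.1) == e.2); last by exists o0.
  by case: e {Lp pE} => x y; move: x y; apply: I3_ind; apply: I3_ind;
    rewrite /= !I3E => // _; exists o1.
have := totally_reducible_trace i (i + e.1) tr (etrans rp pE).
rewrite (entry_inv_lcoord _ _ (edge_unit e t)) !lcoord_edge.
have -> : i + e.1 - i = e.1 by rewrite addrC addKr.
rewrite edge_coord_inl [edge_coord _ _ (inr _)]edge_coord_off; last first.
  by rewrite /incident /= -[inr _ == _]/(_ == e.2).
rewrite addr0 /= => tt; move/negP: t1; apply; apply/eqP/(mulfI t0).
by rewrite mulr1 -expr2.
Qed.

End TotallyReducible.

(** * Strata and incidences *)

Section Incidences.
Variables (K : numClosedFieldType) (n m : nat) (tau : component_type K n m).
Notation rho := (rho tau).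
Notation orbits := (orbits_from tau).

Lemma component_image :
  [set sval (phi tau p) | p in [set GL3pt M | M in irreducible_locus tau]] =
  component tau.
Proof.
apply/seteqP; split=> [_ [_ [M irr <-] <-]|p /component_rho[M irr ->]].
  by rewrite phi_GL3pt; apply/component_rho; exists M.
by exists (GL3pt M); [exists M|rewrite phi_GL3pt].
Qed.

Lemma zero_corner_line (M : 'M[K]_3) : zero_corner M -> zero_line M.
Proof. by case=> i [j [ri _ _]]; left; exists i. Qed.

Lemma boundary_strata : boundary tau =
  orbits (fun M => zero_line M /\ ~ zero_corner M) `|`
  orbits (fun M => zero_corner M).
Proof.
apply/seteqP; split=> [p bp|p [[M [zl _] <-]|[M /zero_corner_line zl <-]]].
- have [M pM] := closure_orbit bp.1; rewrite pM in bp *.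
  have /boundary_rho zl := bp.
  by case: (EM (zero_corner (sval M))) => zc; [right|left]; exists M.
- exact/boundary_rho.
- exact/boundary_rho.
Qed.

Lemma orbits_two_zeroes :
  orbits (fun M => zero_line M /\ ~ zero_corner M) =
  orbits (fun M => zero_line M /\ zero_count M = 2%N).
Proof.
apply/seteqP; split=> [p [M [zl nc] <-]|p [M [zl c2] <-]]; last first.
  by exists M => //; split=> // /zero_corner_count; rewrite c2.
have [e [t [t0 t1 ->]]] := generic_stratum tau zl nc.
exists (edge_GL e t) => //; split; first exact: edge_zero_line.
exact: edge_zero_count.
Qed.

Lemma orbits_three_zeroes :
  orbits (fun M => zero_corner M) =
  orbits (fun M => zero_corner M /\ zero_count M = 3%N).
Proof.
apply/seteqP; split=> [p [M zc <-]|p [M [zc _] <-]]; last by exists M.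
have [e [t [t01 ->]]] := corner_stratum tau zc.
by exists (edge_GL e t) => //; apply: edge_corner.
Qed.

Lemma line_partially_reducible e :
  line tau e `\` range (vertex tau) `<=`
  partially_reducible_pts (n:=n) (m:=m).
Proof.
move=> p [Lp nv]; have [t [t0 t1 ->]] := line_generic Lp nv.
exists (rho (edge_GL e t)) => //; apply: zero_line_partially_reducible.
  exact: edge_zero_line.
by move=> /zero_corner_count; rewrite edge_zero_count.
Qed.

Lemma line_cap_vertices e e' : e <> e' ->
  line tau e `&` line tau e' =
  [set vertex tau w | w in [set w | K33_incident e w /\ K33_incident e' w]].
Proof.
move=> ee'; apply/seteqP; split=> [p [L L']|_ [w [ew ew'] <-]].
  by have [w [ew ew'] <-] := line_cap ee' L L'; exists w.
by split; apply/line_vertex.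
Qed.

Lemma crossing_points :
  [set p | exists e e', [/\ e <> e', line tau e p & line tau e' p]] =
  range (vertex tau).
Proof.
apply/seteqP; split=> [p [e [e' [ee' L L']]]|_ [w _ <-]].
  by have [w _ <-] := line_cap ee' L L'; exists w.
case: w => c.
  by exists (c, o0), (c, o1); split; [case|apply/line_vertex; left..].
by exists (o0, c), (o1, c); split; [case|apply/line_vertex; right..].
Qed.

End Incidences.

Unset Implicit Arguments.
Set Strict Implicit.

Theorem proposition9p2 (R : realType) (m n : nat)
    (m_gt0 : (0 < m)%N) (n_gt0 : (0 < n)%N) (mn_coprime : coprime m n)
    (tau : component_type R[i] n m) :
  (* the closure is GL3 // H, via the map induced by M |-> rho M *)
  (exists phi : GL3_mod_H R[i] -> subvariety (zclosure (component tau)),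
     [/\ isomorphism phi,
         forall M : GL3 R[i], sval (phi (GL3pt M)) = charpt (rho tau M)
       & [set sval (phi p) | p in [set GL3pt M | M in irreducible_locus tau]]
         = component tau])
  /\
  (* the boundary strata *)
  [/\ boundary tau =
        orbits_from tau (fun M => zero_line M /\ ~ zero_corner M) `|`
        orbits_from tau (fun M => zero_corner M),
      orbits_from tau (fun M => zero_line M /\ ~ zero_corner M) =
        orbits_from tau (fun M => zero_line M /\ zero_count M = 2%N),
      orbits_from tau (fun M => zero_corner M) =
        orbits_from tau (fun M => zero_corner M /\ zero_count M = 3%N),
      forall M : GL3 R[i], zero_line (sval M) -> ~ zero_corner (sval M) ->
        partially_reducible n m (sval (rho tau M))
    & forall M : GL3 R[i], zero_corner (sval M) ->
        totally_reducible n m (sval (rho tau M))]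
  /\
  (* the nine lines L and the six intersection points v *)
  (exists (L : K33_edge -> set (charvar R[i] n m))
          (v : K33_vertex -> charvar R[i] n m),
     [/\ injective L /\ injective v,
         forall e, zclosed (L e) /\
           exists psi : affine_line R[i] -> subvariety (L e), isomorphism psi,
         boundary tau = \bigcup_(e in [set: K33_edge]) L e
       & forall e, L e `\` range v `<=` partially_reducible_pts (n:=n) (m:=m)]
     /\
     [/\ forall e w, L e (v w) <-> K33_incident e w,
         forall e e', e <> e' ->
           L e `&` L e' =
           [set v w | w in [set w | K33_incident e w /\ K33_incident e' w]],
         [set p | exists e e', [/\ e <> e', L e p & L e' p]] = range v
       & range v = boundary tau `&` totally_reducible_pts (n:=n) (m:=m)]).
Proof.
split.
  exists (phi tau); split; [exact: phi_isomorphism|exact: phi_GL3pt|].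
  exact: component_image.
split.
  split; [exact: boundary_strata|exact: orbits_two_zeroes
    |exact: orbits_three_zeroes|exact: zero_line_partially_reducible
    |exact: zero_corner_totally_reducible].
exists (line tau), (vertex tau); split; split.
- by split; [exact: line_inj|exact: vertex_inj].
- move=> e; split; first exact: zclosed_line.
  by exists (@line_param _ _ _ tau e); apply: line_isomorphism.
- exact: boundary_lines.
- exact: line_partially_reducible.
- exact: line_vertex.
- exact: line_cap_vertices.
- exact: crossing_points.
- exact: range_vertex.
Qed.
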